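(* Let $p$ be a prime and let $G$ be a finite $p$-group with $d(G)=3$, $\Phi(G)\le Z(G)$, $G'\cong C_p^3$ and $G/G'$ of type $(p^{m_1},p^{m_2},p^{m_3})$ with $m_1>m_2>m_3$, and suppose $G$ is determined by one of the characteristic matrices (A1)–(A6), (B1)–(B18), (C1)–(C10) listed in the context. (1) If $I_{\min}=m_3$, then the characteristic matrix is one of: (A1)–(A6), (B1)–(B4), (B15)–(B16). (2) If $I_{\min}=m_3+1$, then the characteristic matrix is one of: (B5)–(B14), (B17)–(B18), (C1)–(C6). (3) If $I_{\min}=m_3+2$, then the characteristic matrix is one of: (C7)–(C10). (4) If $I_{\max}=m_1+2$, then the characteristic matrix is one of: (B13)–(B16), (C1)–(C4), (C9)–(C10). (5) If $I_{\max}=m_1+1$, then the characteristic matrix is one of: (A3)–(A6), (B1)–(B12), (B18) with $m_1=m_2+1$, (C5)–(C8). (6) If $I_{\max}=m_1$, then the characteristic matrix is one of: (A1)–(A2), (B17), (B18) with $m_1>m_2+1$.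
   Context: $d(G)$ is the minimal number of generators, $\Phi(G)$ the Frattini subgroup, $G'$ the derived subgroup, $C_p^3$ elementary abelian of order $p^3$, $F_p$ the field with $p$ elements. An $\mathcal{A}_1$-group is a minimal non-abelian group (non-abelian with all proper subgroups abelian). $p^{I_{\min}}$ and $p^{I_{\max}}$ denote respectively the minimal and the maximal index in $G$ of $\mathcal{A}_1$-subgroups of $G$. Characteristic matrix: let $G/G'$ have type $(p^{m_1},p^{m_2},p^{m_3})$, $m_1\ge m_2\ge m_3\ge1$ (i.e. $G/G'\cong C_{p^{m_1}}\times C_{p^{m_2}}\times C_{p^{m_3}}$). Choose $a_1,a_2,a_3\in G$ with $G/G'=\langle a_1G'\rangle\times\langle a_2G'\rangle\times\langle a_3G'\rangle$, $o(a_iG')=p^{m_i}$; put $x=[a_2,a_3]$, $y=[a_3,a_1]$, $z=[a_1,a_2]$, so $G'=\langle x,y,z\rangle$, and write $a_i^{p^{m_i}}=x^{w_{i1}}y^{w_{i2}}z^{w_{i3}}$. The matrix $w(G)=(w_{ij})$ over $F_p$ is called a characteristic matrix of $G$; together with $p,m_1,m_2,m_3$ it determines $G$ up to isomorphism. Let $e_{ij}$ be the $3\times3$ matrix over $F_p$ with $1$ at $(i,j)$ and $0$ elsewhere; $\eta$ a fixed square non-residue modulo odd $p$; $\nu,\nu_1,\nu_2\in\{1,\eta\}$ (equal to $1$ if $p=2$); $t\in F_p$, $t\neq0$. The list is: (A1) $e_{11}+\nu_1e_{22}+\nu_2e_{33}$; (A2) $e_{11}+e_{23}+te_{32}$; (A3)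 $te_{13}+e_{22}+e_{31}$; (A4) $e_{13}+e_{21}+e_{32}$; (A5) $e_{12}+e_{23}+e_{31}$; (A6) $te_{12}+e_{21}+e_{33}$; (B1) $e_{11}+\nu e_{22}$; (B2) $e_{11}+e_{23}$; (B3) $e_{13}+e_{22}$; (B4) $e_{12}+e_{23}$; (B5) $e_{13}+e_{32}$; (B6) $e_{11}+\nu e_{33}$; (B7) $e_{11}+e_{32}$; (B8) $e_{12}+e_{33}$; (B9) $e_{22}+e_{31}$; (B10) $e_{23}+e_{31}$; (B11) $e_{21}+e_{33}$; (B12) $e_{21}+e_{32}$; (B13) $e_{12}+e_{31}$; (B14) $te_{13}+e_{31}$; (B15) $e_{13}+e_{21}$; (B16) $te_{12}+e_{21}$; (B17) $e_{22}+\nu e_{33}$; (B18) $e_{23}+te_{32}$; (C1) $e_{11}$; (C2) $e_{12}$; (C3) $e_{13}$; (C4) $e_{21}$; (C5) $e_{22}$; (C6) $e_{23}$; (C7) $e_{33}$; (C8) $e_{32}$; (C9) $e_{31}$; (C10) $0$. *)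

(* Defs.v *)
From mathcomp Require Import all_boot all_order all_algebra.
From mathcomp Require Import all_fingroup all_solvable.

Set Implicit Arguments.
Unset Strict Implicit.
Unset Printing Implicit Defensive.

Import GroupScope GRing.Theory.

Definition A1_group (gT : finGroupType) (H : {group gT}) : Prop :=
  ~~ abelian H /\ (forall K : {group gT}, K \proper H -> abelian K).

Definition A1_subgroup (gT : finGroupType) (G H : {group gT}) : Prop :=
  H \subset G /\ A1_group H.

(* "I = I_min" and "I = I_max", as relations. *)
Definition is_Imin (p : nat) (gT : finGroupType) (G : {group gT}) (I : nat) :
    Prop :=
  (exists2 H : {group gT}, A1_subgroup G H & #|G : H| = (p ^ I)%N) /\
  (forall H : {group gT}, A1_subgroup G H -> p ^ I <= #|G : H|)%N.

Definition is_Imax (p : nat) (gT : finGroupType) (G : {group gT}) (I : nat) :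
    Prop :=
  (exists2 H : {group gT}, A1_subgroup G H & #|G : H| = (p ^ I)%N) /\
  (forall H : {group gT}, A1_subgroup G H -> #|G : H| <= p ^ I)%N.

(* Rows and columns are numbered from 1, so that [ix 1], [ix 2], [ix 3]
   are the three elements of 'I_3. *)
Definition ix (k : nat) : 'I_3 := inord k.-1.
Arguments ix k%_N.

Definition e (p i j : nat) : 'M['F_p]_3 := delta_mx (ix i) (ix j).
Arguments e {p} i%_N j%_N.

(* [w] is a characteristic matrix of G, for some choice of a1, a2, a3.
   The entries of w are used as exponents through their representatives in
   {0, ..., p-1}; this is harmless since G' has exponent p. The commutator is
   [~ a, b] = a^-1 * b^-1 * a * b. *)
Definition char_matrix (p m1 m2 m3 : nat) (gT : finGroupType)
    (G : {group gT}) (w : 'M['F_p]_3) : Prop :=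
  exists a1 a2 a3 : gT,
    let x := [~ a2, a3] in
    let y := [~ a3, a1] in
    let z := [~ a1, a2] in
    let row_value i :=
      x ^+ (w (ix i) (ix 1)) * y ^+ (w (ix i) (ix 2)) * z ^+ (w (ix i) (ix 3)) in
    [/\ [/\ a1 \in G, a2 \in G & a3 \in G],
        <[coset G^`(1) a1]> \x <[coset G^`(1) a2]> \x <[coset G^`(1) a3]>
          = G / G^`(1),
        [/\ #[coset G^`(1) a1] = (p ^ m1)%N,
            #[coset G^`(1) a2] = (p ^ m2)%N
          & #[coset G^`(1) a3] = (p ^ m3)%N]
      & [/\ a1 ^+ (p ^ m1) = row_value 1%N,
            a2 ^+ (p ^ m2) = row_value 2%N
          & a3 ^+ (p ^ m3) = row_value 3%N]].

Local Open Scope ring_scope.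

Definition nonresidue (p : nat) (eta : 'F_p) : Prop :=
  forall s : 'F_p, s ^+ 2 <> eta.

(* The range of nu, nu_1 and nu_2: {1, eta} for p odd, and {1} for p = 2. *)
Definition nu_range (p : nat) (eta nu : 'F_p) : Prop :=
  nu = 1 \/ (odd p /\ nu = eta).

Definition caseA (p : nat) (eta : 'F_p) (k : nat) (w : 'M['F_p]_3) : Prop :=
  match k with
  | 1%N => exists nu1 nu2 : 'F_p, [/\ nu_range eta nu1, nu_range eta nu2
             & w = e 1 1 + nu1 *: e 2 2 + nu2 *: e 3 3]
  | 2%N => exists2 t : 'F_p, t != 0 & w = e 1 1 + e 2 3 + t *: e 3 2
  | 3%N => exists2 t : 'F_p, t != 0 & w = t *: e 1 3 + e 2 2 + e 3 1
  | 4%N => w = e 1 3 + e 2 1 + e 3 2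
  | 5%N => w = e 1 2 + e 2 3 + e 3 1
  | 6%N => exists2 t : 'F_p, t != 0 & w = t *: e 1 2 + e 2 1 + e 3 3
  | _ => False
  end.

Definition caseB (p : nat) (eta : 'F_p) (k : nat) (w : 'M['F_p]_3) : Prop :=
  match k with
  | 1%N => exists2 nu : 'F_p, nu_range eta nu & w = e 1 1 + nu *: e 2 2
  | 2%N => w = e 1 1 + e 2 3
  | 3%N => w = e 1 3 + e 2 2
  | 4%N => w = e 1 2 + e 2 3
  | 5%N => w = e 1 3 + e 3 2
  | 6%N => exists2 nu : 'F_p, nu_range eta nu & w = e 1 1 + nu *: e 3 3
  | 7%N => w = e 1 1 + e 3 2
  | 8%N => w = e 1 2 + e 3 3
  | 9%N => w = e 2 2 + e 3 1
  | 10%N => w = e 2 3 + e 3 1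
  | 11%N => w = e 2 1 + e 3 3
  | 12%N => w = e 2 1 + e 3 2
  | 13%N => w = e 1 2 + e 3 1
  | 14%N => exists2 t : 'F_p, t != 0 & w = t *: e 1 3 + e 3 1
  | 15%N => w = e 1 3 + e 2 1
  | 16%N => exists2 t : 'F_p, t != 0 & w = t *: e 1 2 + e 2 1
  | 17%N => exists2 nu : 'F_p, nu_range eta nu & w = e 2 2 + nu *: e 3 3
  | 18%N => exists2 t : 'F_p, t != 0 & w = e 2 3 + t *: e 3 2
  | _ => False
  end.

Definition caseC (p : nat) (k : nat) (w : 'M['F_p]_3) : Prop :=
  match k with
  | 1%N => w = e 1 1
  | 2%N => w = e 1 2
  | 3%N => w = e 1 3
  | 4%N => w = e 2 1
  | 5%N => w = e 2 2
  | 6%N => w = e 2 3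
  | 7%N => w = e 3 3
  | 8%N => w = e 3 2
  | 9%N => w = e 3 1
  | 10%N => w = 0
  | _ => False
  end.

(* [inA eta i j w]: w is one of the matrices (Ai)-(Aj); similarly for B, C. *)
Definition inA (p : nat) (eta : 'F_p) (i j : nat) (w : 'M['F_p]_3) : Prop :=
  exists2 k, (i <= k <= j)%N & caseA eta k w.

Definition inB (p : nat) (eta : 'F_p) (i j : nat) (w : 'M['F_p]_3) : Prop :=
  exists2 k, (i <= k <= j)%N & caseB eta k w.

Definition inC (p : nat) (i j : nat) (w : 'M['F_p]_3) : Prop :=
  exists2 k, (i <= k <= j)%N & caseC k w.

Arguments inA {p} eta i%_N j%_N w.
Arguments inB {p} eta i%_N j%_N w.
Arguments inC {p} i%_N j%_N w.

(* Main.v *)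
Require Import Defs.
From mathcomp Require Import all_boot all_order all_algebra.
From mathcomp Require Import all_fingroup all_solvable.
From mathcomp Require Import mxabelem zify.
Import GroupScope GRing.Theory.

(** Two elements u, v of G that do not commute generate an A_1-subgroup, and every
    A_1-subgroup arises in this way. Writing G' additively as F_p^3 in the basis x, y, z,
    the commutator becomes the cross product and the p^{m_i}-th power of a_i is the i-th row w_i of w.
    An A_1-subgroup H contains a pair of generators in echelon form, with one of a_3, a_2, a_1
    as the non-pivot: (a_1 a_3^s, a_2 a_3^t), (a_3 a_2^{pr}, a_1 a_2^s) or
    (a_2 a_1^{pr}, a_3 a_1^{ps}), up to factors in G'. Then |G : H| = |G : HG'| p^3 / |H \cap G'|,
    where G / HG' is cyclic, generated by the non-pivot, and H \cap G' is spanned by [u, v] and by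
    combinations of rows of w. The first shape gives I_min = m_3 + 2 - rank(w_1, w_2); the second and
    the third ones decide I_max, whose value is m_1 + 3 minus the least rank of
    ((1,0,0), w_2 + r w_1, w_3 + s w_1), except that (a_3, a_1) does better for (B18)
    when m_1 = m_2 + 1. *)

Set Implicit Arguments.
Unset Strict Implicit.
Unset Printing Implicit Defensive.

(** * Two-generator subgroups and minimal non-abelian groups *)

(** Modulo K the elements u and v commute, so the image of <u, v> is a product of two cyclic groups
    of orders at most m and n. Every upper bound on the order of an A_1-subgroup below comes from
    this. *)
Lemma card_gen2_central (gT : finGroupType) (K : {group gT}) (u v : gT) (m n : nat) :
    0 < m -> 0 < n -> u \in 'C(K) -> v \in 'C(K) ->
    [~ u, v] \in K -> u ^+ m \in K -> v ^+ n \in K ->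
  #|<<[set u; v]>> <*> K| <= m * n * #|K|.
Proof.
move=> m_gt0 n_gt0 cKu cKv Kuv Kum Kvn; set L := <<[set u; v]>>%G.
have nKu : u \in 'N(K) by apply: subsetP cKu; apply: cent_sub.
have nKv : v \in 'N(K) by apply: subsetP cKv; apply: cent_sub.
have nKL : L \subset 'N(K) by rewrite gen_subG subUset !sub1set nKu.
have nKLK : L <*> K \subset 'N(K) by rewrite join_subG nKL normG.
rewrite -(Lagrange (joing_subr L K)) mulnC -card_quotient // leq_mul //.
rewrite quotientYidr //.
rewrite quotient_gen ?subUset ?sub1set ?nKu // quotientU !quotient_set1 //.
rewrite -joingE -joing_idl -joing_idr -!/(cycle _).
have cuv : commute (coset K u) (coset K v).
  by apply/commgP; rewrite -morphR //=; apply/eqP; rewrite coset_id.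
rewrite norm_joinEl; last first.
  by rewrite cents_norm // cent_cycle cycle_subG; apply/cent1P.
apply: (@leq_trans (#[coset K u] * #[coset K v])).
  by rewrite /order mul_cardG leq_pmulr // (cardD1 1) group1.
by apply: leq_mul; rewrite dvdn_leq // order_dvdn -morphX //= coset_id.
Qed.

Lemma A1_gen2 (gT : finGroupType) (H : {group gT}) (u v : gT) :
  A1_group H -> u \in H -> v \in H -> [~ u, v] != 1 -> <<[set u; v]>> = H.
Proof.
case=> _ minH Hu Hv ncuv; apply/eqP; apply: contraR ncuv => neqH.
have /minH /centsP abL : <<[set u; v]>>%G \proper H.
  by rewrite properEneq neqH gen_subG subUset !sub1set Hu.
by apply/commgP/abL; apply: mem_gen; rewrite !inE eqxx ?orbT.
Qed.

Lemma A1_noncomm (gT : finGroupType) (H : {group gT}) :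
  A1_group H -> exists u v, [/\ u \in H, v \in H & [~ u, v] != 1].
Proof.
case=> /centsP nabH _; have [|] := boolP [forall u in H, [forall v in H, [~ u, v] == 1]].
  move/forall_inP => ab; case: nabH => u Hu v Hv.
  by apply/commgP; move/forall_inP: (ab u Hu); apply.
rewrite negb_forall_in => /exists_inP[u Hu].
by rewrite negb_forall_in => /exists_inP[v Hv ncuv]; exists u, v.
Qed.

(* Phi(H) is central of index at most p^2, so H has no room for a nonabelian proper subgroup. *)
Lemma gen2_A1 (p : nat) (gT : finGroupType) (G : {group gT}) (u v : gT) :
    prime p -> p.-group G -> 'Phi(G) \subset 'Z(G) ->
    u \in G -> v \in G -> [~ u, v] != 1 ->
  A1_group <<[set u; v]>>.
Proof.
move=> p_pr pG PhiZ Gu Gv ncuv; set H := <<[set u; v]>>%G.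
have Hu : u \in H by apply: mem_gen; rewrite !inE eqxx.
have Hv : v \in H by apply: mem_gen; rewrite !inE eqxx orbT.
have sHG : H \subset G by rewrite gen_subG subUset !sub1set Gu.
have pH := pgroupS sHG pG.
have cPhi : 'Phi(H) \subset 'C(H).
  apply: subset_trans (PhiS pG sHG) _; apply: subset_trans PhiZ _.
  by apply: subset_trans (subsetIr _ _) (centS sHG).
have cC : H \subset 'C('Phi(H)) by rewrite centsC.
have sPhiH := Phi_sub H.
have PhiX w : w \in H -> w ^+ p \in 'Phi(H).
  move=> Hw; rewrite (Phi_joing pH); apply: (subsetP (joing_subr _ _)).
  by rewrite -[p in w ^+ p]expn1 Mho_p_elt // (mem_p_elt pH).
have PhiR : [~ u, v] \in 'Phi(H).
  by rewrite (Phi_joing pH); apply: (subsetP (joing_subl _ _)); apply: mem_commg.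
have p_gt0 := prime_gt0 p_pr.
have leH : #|H| <= p * p * #|'Phi(H)|.
  apply: leq_trans (subset_leq_card (joing_subl _ _)) _.
  by apply: card_gen2_central; rewrite ?PhiX ?(subsetP cC).
split; first by apply: contra ncuv => /centsP cHH; apply/commgP/cHH.
move=> K ltKH; have sKH := proper_sub ltKH.
suff : abelian ('Phi(H) <*> K) by apply: abelianS; apply: joing_subr.
have sMH : 'Phi(H) <*> K \subset H by rewrite join_subG sPhiH.
have nPhiM : 'Phi(H) <*> K \subset 'N('Phi(H)).
  by rewrite cents_norm // (subset_trans sMH).
(* Since Phi(H) is central, Phi(H)K is abelian as soon as its quotient by Phi(H) is cyclic. *)
apply: (@cyclic_factor_abelian _ 'Phi(H)%G).
  rewrite subsetI joing_subl /=; apply: subset_trans cPhi _; exact: centS.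
have ltM : #|H : 'Phi(H) <*> K| %| 1 -> False.
  rewrite dvdn1 indexg_eq1 => sHM; have /Phi_nongen : 'Phi(H) <*> K = H.
    by apply/eqP; rewrite eqEsubset sMH.
  by rewrite genGid => KH; rewrite KH properxx in ltKH.
apply: (@dvdn_prime_cyclic _ _ p) => //; rewrite card_quotient //.
have : p.-nat #|'Phi(H) <*> K : 'Phi(H)| by apply: pnat_dvd (dvdn_indexg _ _) (pgroupS sMH pH).
case/p_natP => // j jE.
have : p.-nat #|H : 'Phi(H) <*> K|.
  by apply: pnat_dvd (dvdn_indexg _ _) pH.
case/p_natP => // i iE.
(* Here i >= 1, because Phi(H) consists of non-generators and K is proper; with i + j <= 2 this
   leaves j <= 1. *)
have : #|H : 'Phi(H)| <= p ^ 2.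
  by rewrite -(@leq_pmul2l #|'Phi(H)|) // Lagrange // mulnC -mulnn.
rewrite -(Lagrange_index sMH) ?joing_subl // iE jE -expnD leq_exp2l ?prime_gt1 //.
move: ltM; rewrite iE; case: i {iE} => [|i] H1; first by case: H1.
move=> leij; rewrite -[X in _ %| X]expn1 dvdn_exp2l //.
by rewrite -ltnS (leq_trans _ leij) // addSn ltnS leq_addl.
Qed.

(** * Additive coordinates on an elementary abelian subgroup *)

Section Coordinates.

Variables (p : nat) (p_pr : prime p) (gT : finGroupType) (E : {group gT}).
Hypothesis abelE : p.-abelem E.

(** Applied to the three basic commutators and a row of [w], this is the [row_value] of
    [char_matrix]. *)
Definition gp (x y z : gT) (v : 'rV['F_p]_3) : gT :=
  x ^+ v 0%R (ix 1) * y ^+ v 0%R (ix 2) * z ^+ v 0%R (ix 3).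

Lemma expg_Fp_nat (x : gT) (n : nat) : x \in E -> x ^+ (n%:R : 'F_p)%R = x ^+ n.
Proof.
move=> Ex; rewrite val_Fp_nat //; apply: expg_mod.
by have /abelemP[//|_ ->] := abelE.
Qed.

Lemma expg_FpD (x : gT) (a b : 'F_p) : x \in E -> x ^+ (a + b)%R = x ^+ a * x ^+ b.
Proof.
by move=> Ex; rewrite -expgD -[in RHS]expg_Fp_nat // natrD !natr_Zp.
Qed.

Variables x y z : gT.
Hypotheses (Ex : x \in E) (Ey : y \in E) (Ez : z \in E).

Lemma gp_in v : gp x y z v \in E.
Proof. by rewrite !groupM ?groupX. Qed.

Lemma gpD : {morph gp x y z : u v / (u + v)%R >-> u * v}.
Proof.
have /abelemP[//|cEE _] := abelE.
move=> u v; rewrite /gp !mxE !expg_FpD //.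
have cE i j k l : (i \in E) -> (j \in E) -> (k \in E) -> l \in E -> (i * j) * (k * l) = (i * k) * (j * l).
  move=> Ei Ej Ek El; rewrite -!mulgA; congr (_ * _); rewrite !mulgA; congr (_ * _).
  exact: (centsP cEE).
rewrite [X in X * _ = _]cE ?groupX // [LHS]cE ?(groupM, groupX) //.
Qed.

End Coordinates.

Lemma ix_neq : (ix 1 == ix 2 = false) * (ix 1 == ix 3 = false) * (ix 2 == ix 3 = false)
  * (ix 2 == ix 1 = false) * (ix 3 == ix 1 = false) * (ix 3 == ix 2 = false).
Proof. by rewrite -!val_eqE /= !inordK. Qed.

Lemma ix_cases (P : 'I_3 -> Prop) : P (ix 1) -> P (ix 2) -> P (ix 3) -> forall i, P i.
Proof.
move=> P1 P2 P3 [[|[|[|//]]] lti]; [move: P1|move: P2|move: P3];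
  by congr P; apply: val_inj; rewrite /= inordK.
Qed.

Lemma submx_addr (F : fieldType) n n1 n2 k (v : 'M[F]_(k, n)) (A : 'M_(n1, n)) (B : 'M_(n2, n)) :
  (v <= B)%MS -> (v <= A + B)%MS.
Proof. by move/submx_trans; apply; apply: addsmxSr. Qed.

Lemma submx_addl (F : fieldType) n n1 n2 k (v : 'M[F]_(k, n)) (A : 'M_(n1, n)) (B : 'M_(n2, n)) :
  (v <= A)%MS -> (v <= A + B)%MS.
Proof. by move/submx_trans; apply; apply: addsmxSl. Qed.

Lemma exponent_pivot1 m1 m2 m3 r e : r <= 2 -> e <= 1 + r ->
  m1 + m2 + e + (m3 + 2 - r) <= m1 + m2 + m3 + 3.
Proof. lia. Qed.

Lemma exponent_pivot2 m1 m2 m3 r e : r <= 2 -> 0 < m2 -> e <= minn 3 (2 + r) ->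
  m2.-1 + m1 + e + (m3 + 2 - r) <= m1 + m2 + m3 + 3.
Proof. lia. Qed.

Lemma exponent_pivot3 m1 m2 m3 r e : r <= 2 -> m3 < m1 -> 0 < m2 -> e <= minn 3 (2 + r) ->
  m2 + m3 + (m1 - m3.+1 + e) + (m3 + 2 - r) <= m1 + m2 + m3 + 3.
Proof. lia. Qed.

Lemma exponent_rank_succ m3 r e : r <= 2 -> r < e -> m3 + 3 <= m3 + 2 - r + e.
Proof. lia. Qed.

Lemma exponent_pair23 m1 m2 m3 e : e <= 3 -> m2 + m3 + e + (m1 + 3 - e) <= m1 + m2 + m3 + 3.
Proof. lia. Qed.

Lemma exponent_pair31 m1 m2 m3 e : e <= 3 -> m3 + m1 + e + (m2 + 3 - e) <= m1 + m2 + m3 + 3.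
Proof. lia. Qed.

Lemma rank_adds_row (F : fieldType) n (u v : 'rV[F]_n) :
  u != 0%R -> ~~ (v <= u)%MS -> 1 < \rank (u + v)%MS.
Proof.
move=> nzu vu; suff : \rank u < \rank (u + v)%MS by rewrite [\rank u]rank_rV nzu.
by rewrite rank_ltmx // ltmxE addsmxSl addsmx_sub submx_refl.
Qed.

Lemma rank_adds_coord (F : fieldType) n (u v : 'rV[F]_n) j :
  u != 0%R -> u 0%R j = 0%R -> v 0%R j != 0%R -> 1 < \rank (u + v)%MS.
Proof.
move=> nzu uj vj; apply: rank_adds_row => //.
by apply: contra vj => /sub_rVP[c ->]; rewrite mxE uj mulr0.
Qed.

(** * Commutator calculus in class two *)

Section ThreeGenerators.

Variables (p : nat) (p_pr : prime p) (gT : finGroupType) (G : {group gT}).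
Hypotheses (pG : p.-group G) (PhiZ : 'Phi(G) \subset 'Z(G)).
Hypotheses (abelG' : p.-abelem G^`(1)) (cardG' : #|G^`(1)| = (p ^ 3)%N).
Variables (m1 m2 m3 : nat).
Hypotheses (m3_gt0 : 0 < m3) (lt_m32 : m3 < m2) (lt_m21 : m2 < m1).
Variables (a1 a2 a3 : gT).
Hypotheses (Ga1 : a1 \in G) (Ga2 : a2 \in G) (Ga3 : a3 \in G).
Hypothesis defG : <[coset G^`(1) a1]> \x <[coset G^`(1) a2]> \x <[coset G^`(1) a3]>
  = G / G^`(1).
Hypotheses (o1 : #[coset G^`(1) a1] = (p ^ m1)%N)
  (o2 : #[coset G^`(1) a2] = (p ^ m2)%N) (o3 : #[coset G^`(1) a3] = (p ^ m3)%N).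

Let g := @gp p gT [~ a2, a3] [~ a3, a1] [~ a1, a2].
Let d k : 'rV['F_p]_3 := delta_mx 0%R (ix k).

Variable w : 'M['F_p]_3.
Let w1 : 'rV_3 := row (ix 1) w.
Let w2 : 'rV_3 := row (ix 2) w.
Let w3 : 'rV_3 := row (ix 3) w.
Hypotheses (pow1 : a1 ^+ (p ^ m1) = g w1) (pow2 : a2 ^+ (p ^ m2) = g w2)
  (pow3 : a3 ^+ (p ^ m3) = g w3).

Lemma der_sub_center : G^`(1) \subset 'Z(G).
Proof.
by apply: subset_trans PhiZ; rewrite (Phi_joing pG) joing_subl.
Qed.

Let cG' u : u \in G^`(1) -> u \in 'C(G).
Proof. by move/(subsetP der_sub_center); rewrite inE => /andP[]. Qed.

Let G'G u : u \in G^`(1) -> u \in G.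
Proof. exact: (subsetP (der_sub 1 G)). Qed.

Let cC u v : u \in G^`(1) -> v \in G -> commute u v.
Proof. by move=> /cG' /centP; apply. Qed.

Let R u v : u \in G -> v \in G -> [~ u, v] \in G^`(1).
Proof. exact: mem_commg. Qed.

Let nG' : G \subset 'N(G^`(1)).
Proof. exact: der_norm. Qed.

Lemma pX_central u : u \in G -> u ^+ p \in 'C(G).
Proof.
move=> Gu; suff /(subsetP PhiZ) : u ^+ p \in 'Phi(G) by rewrite inE => /andP[].
rewrite (Phi_joing pG); apply: (subsetP (joing_subr _ _)).
by rewrite -[p in u ^+ p]expn1 Mho_p_elt // (mem_p_elt pG).
Qed.

Lemma class2MR u v t : u \in G -> v \in G -> t \in G ->
  [~ u * v, t] = [~ u, t] * [~ v, t].
Proof. by move=> Gu Gv Gt; rewrite commMgJ conjgE (cC (R Gu Gt) Gv) mulKg. Qed.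

Lemma class2RM u v t : u \in G -> v \in G -> t \in G ->
  [~ t, u * v] = [~ t, u] * [~ t, v].
Proof.
move=> Gu Gv Gt; rewrite commgMJ conjgE (cC (R Gt Gu) Gv) mulKg.
exact: (cC (R Gt Gv)) (G'G (R Gt Gu)).
Qed.

Lemma class2XR u v n : u \in G -> v \in G -> [~ u ^+ n, v] = [~ u, v] ^+ n.
Proof. by move=> Gu Gv; apply: commXg; apply/commute_sym/(cC (R Gu Gv)). Qed.

Lemma class2RX u v n : u \in G -> v \in G -> [~ u, v ^+ n] = [~ u, v] ^+ n.
Proof. by move=> Gu Gv; apply: commgX; apply/commute_sym/(cC (R Gu Gv)). Qed.

Lemma centralR c u : c \in 'C(G) -> u \in G -> [~ c, u] = 1.
Proof. by move=> /centP cc Gu; apply/eqP/commgP/cc. Qed.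

Lemma central_R c u : c \in 'C(G) -> u \in G -> [~ u, c] = 1.
Proof. by move=> cc Gu; rewrite -invg_comm centralR ?invg1. Qed.

Lemma derX n u : p %| n -> u \in G^`(1) -> u ^+ n = 1.
Proof.
move=> /dvdnP[q ->] G'u; have /abelemP[//|_ up] := abelG'.
by rewrite mulnC expgM up ?expg1n.
Qed.

(** * The isomorphism between F_p^3 and G' *)

Let g_in v : g v \in G^`(1).
Proof. by apply: gp_in; apply: R. Qed.

Let gM : {in [set: 'rV['F_p]_3] &, {morph g : u v / u * v}}.
Proof. by move=> u v _ _; apply: (gpD p_pr abelG'); apply: R. Qed.

Canonical g_morphism := Morphism gM.

Lemma gD u v : g (u + v)%R = g u * g v.
Proof. exact: gM. Qed.

Lemma gN u : g (- u)%R = (g u)^-1.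
Proof. exact: (@morphV _ _ _ g_morphism). Qed.

Lemma gMn u n : g (u *+ n)%R = g u ^+ n.
Proof. exact: (@morphX _ _ _ g_morphism). Qed.

Lemma gZ (c : 'F_p) u : g (c *: u)%R = g u ^+ c.
Proof. by rewrite -{1}(natr_Zp c) scaler_nat gMn. Qed.

Lemma g_delta : (g (d 1) = [~ a2, a3]) * (g (d 2) = [~ a3, a1]) * (g (d 3) = [~ a1, a2]).
Proof.
by rewrite /g /gp !mxE !eqxx !ix_neq /= !expg1 !expg0 ?mulg1 ?mul1g.
Qed.

(** The a_i generate G modulo G', and G' lies in Phi(G), which consists of non-generators. *)
Lemma gens : <<[set a1; a2; a3]>> = G.
Proof.
set L := <<[set a1; a2; a3]>>%G.
have [La1 La2 La3] : [/\ a1 \in L, a2 \in L & a3 \in L].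
  by split; apply: mem_gen; rewrite !inE eqxx ?orbT.
have sLG : L \subset G by rewrite gen_subG !subUset !sub1set Ga1 Ga2.
apply: Phi_nongen; apply/eqP; rewrite eqEsubset join_subG Phi_sub (subset_trans _ sLG) ?subset_gen //=.
have : G / G^`(1) \subset L / G^`(1).
  have [[B1 B2 eB1 eB2] _ _ _] := dprodP defG.
  by rewrite -(dprodW defG) eB1 -(dprodW eB1) !mul_subG ?cycle_subG ?mem_quotient.
rewrite quotientSK // => /subset_trans; apply.
have sG' : G^`(1) \subset 'Phi(G) by rewrite (Phi_joing pG) joing_subl.
by rewrite -joing_idr (subset_trans (mulSg _ sG')) // mulG_subG joing_subl joing_subr.
Qed.

(** The image of [g] is central and contains the commutators of the generators, so G modulo this
    image is abelian. *)
Lemma der_im : G^`(1) = g @* setT.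
Proof.
apply/eqP; rewrite eqEsubset; apply/andP; split; last first.
  by apply/subsetP=> _ /morphimP[v _ _ ->]; apply: g_in.
set K := g @* setT.
have cKG : K \subset 'C(G) by apply/subsetP=> _ /morphimP[v _ _ ->]; apply: cG'.
have nKG : G \subset 'N(K) by rewrite cents_norm // centsC.
apply: der1_min => //; rewrite -gens quotient_gen ?abelian_gen; last first.
  by rewrite -gen_subG gens.
have gK v : g v \in K by rewrite mem_morphim // inE.
have nK u : u \in G -> u \in 'N(K) by apply: (subsetP nKG).
have comm u v : u \in G -> v \in G -> [~ u, v] \in K -> coset K u \in 'C[coset K v].
  move=> Gu Gv Kuv; apply/cent1P/commgP; rewrite -morphR ?nK //.
  exact/eqP/coset_id.
have K12 : [~ a1, a2] \in K by rewrite -g_delta gK.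
have K31 : [~ a3, a1] \in K by rewrite -g_delta gK.
have K23 : [~ a2, a3] \in K by rewrite -g_delta gK.
have K21 : [~ a2, a1] \in K by rewrite -invg_comm groupV.
have K13 : [~ a1, a3] \in K by rewrite -invg_comm groupV.
have K32 : [~ a3, a2] \in K by rewrite -invg_comm groupV.
rewrite !quotientU !quotient_set1 ?nK // abelianE !centU !cent_set1 !subUset !sub1set !in_setI.
by rewrite !comm // commgg group1.
Qed.

(** A surjection between sets of the same size p^3 is injective. *)
Lemma g_inj : 'injm g.
Proof.
rewrite -card_im_injm -der_im cardG' cardsT card_mx card_Fp //.
Qed.

Lemma g_surj u : u \in G^`(1) -> exists v, u = g v.
Proof. by rewrite der_im => /morphimP[v _ _ ->]; exists v. Qed.

Lemma g_eq1 v : (g v == 1) = (v == 0%R).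
Proof. exact: (morph_injm_eq1 g_inj (in_setT v)). Qed.

(** Row spaces seen as subgroups of G': ranks of matrices become exponents of orders. *)
Definition gs n (M : 'M['F_p]_(n, 3)) := (g @* rowg M)%G.

Lemma card_gs n (M : 'M_(n, 3)) : #|gs M| = (p ^ \rank M)%N.
Proof. by rewrite card_injm ?subsetT ?g_inj // card_rowg card_Fp. Qed.

Lemma mem_gs n (M : 'M_(n, 3)) v : (g v \in gs M) = (v <= M)%MS.
Proof.
by rewrite -sub1set -(morphim_set1 _ (in_setT v)) injmSK ?g_inj ?subsetT // sub1set inE.
Qed.

Lemma gs_sub n (M : 'M_(n, 3)) : gs M \subset G^`(1).
Proof. by rewrite der_im morphimS ?subsetT. Qed.

Lemma cardG : #|G| = (p ^ (m1 + m2 + m3 + 3))%N.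
Proof.
rewrite -(Lagrange (der_sub 1 G)) -card_quotient // -(dprod_card defG).
have [[B1 B2 eB1 eB2] _ _ _] := dprodP defG.
rewrite eB1 -(dprod_card eB1) -!orderE o1 o2 o3 cardG' -!expnD.
by rewrite addnC.
Qed.

(** * The index of H, and the quotient of G by HG' *)

Section Subgroup.

Variables (H : {group gT}) (sHG : H \subset G).

Let NE : H <*> G^`(1) = H * G^`(1).
Proof. by rewrite norm_joinEl // (subset_trans sHG). Qed.

Let nNG : G \subset 'N(H <*> G^`(1)).
Proof. by rewrite sub_der1_norm ?joing_subr // join_subG sHG der_sub. Qed.

(** This is |HG' : H| = |G' : H \cap G'|, multiplied by |G : HG'|. *)
Lemma index_joinD : (#|G : H| * #|H :&: G^`(1)| = #|G : H <*> G^`(1)| * p ^ 3)%N.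
Proof.
have sN : H <*> G^`(1) \subset G by rewrite join_subG sHG der_sub.
apply/eqP; rewrite -(eqn_pmul2l (cardG_gt0 H)) mulnA Lagrange //.
rewrite -(Lagrange sN) /= NE -cardG'; apply/eqP.
by rewrite [LHS]mulnAC -mul_cardG -mulnA; congr (_ * _)%N; rewrite mulnC.
Qed.

Variable a : gT.
Hypotheses (Ga : a \in G) (genHa : H <*> <[a]> = G).

Let NaG : (H <*> G^`(1)) * <[a]> = G.
Proof.
rewrite -norm_joinEr ?(subset_trans _ nNG) ?cycle_subG //.
by rewrite -joingA (joingC _ <[a]>) joingA genHa; apply/joing_idPl/der_sub.
Qed.

(** As G = HG'<a>, write b = h k a^i with k in G', and move k and a^i to the other side. *)
Lemma gen_cycle_rep b : b \in G -> exists s v, b * a ^+ s * g v \in H.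
Proof.
rewrite -NaG NE => /mulsgP[_ c /mulsgP[h k Hh G'k ->] /cycleP[i ->] ->].
have [v kE] := g_surj G'k.
have [s aE] : exists s, (a ^+ i)^-1 = a ^+ s by apply/cycleP; rewrite groupV mem_cycle.
by exists s, (- v)%R; rewrite -aE mulgK gN -kE mulgK.
Qed.

(** The image of a generates G / HG', so its order there is the index of HG'. *)
Lemma exp_in_joinD n : (a ^+ n \in H <*> G^`(1)) = (#|G : H <*> G^`(1)| %| n).
Proof.
have Na : a \in 'N(H <*> G^`(1)) by apply: (subsetP nNG).
have -> : #|G : H <*> G^`(1)| = #[coset (H <*> G^`(1)) a].
  have quot (N : {group gT}) : a \in 'N(N) -> N * <[a]> = G -> #|G / N| = #[coset N a].
    by move=> Na' <-; rewrite quotientMidl quotient_cycle.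
  by rewrite -card_quotient // quot.
rewrite order_dvdn -morphX //; apply/idP/eqP => [|/coset_idr]; first exact: coset_id.
by apply; rewrite groupX.
Qed.

End Subgroup.

(** In class two the correction term is [v, u] raised to the binomial coefficient (p^m choose 2),
    which must be divisible by p; for p = 2 this requires m > 1. *)
Lemma expM_pX u v m : 1 < m -> u \in G -> v \in G ->
  (u * v) ^+ (p ^ m) = u ^+ (p ^ m) * v ^+ (p ^ m).
Proof.
move=> m_gt1 Gu Gv; have cvu := cC (R Gv Gu).
rewrite expMg_Rmul ?(derX _ (R Gv Gu)) ?mulg1 //; try by apply/commute_sym/cvu.
case: m m_gt1 => [|[|m]] // _.
case: (even_prime p_pr) => [p2 | odd_p].
  by rewrite bin2 p2 expnS -mulnA mul2n doubleK expnS -mulnA dvdn_mulr.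
(* For odd p it is enough that p divides twice the binomial coefficient, a falling factorial
   starting with p^m. *)
rewrite -(@Gauss_dvdl _ _ 2) ?coprimen2 // -[2]/(2`!) bin_ffact ffactnS.
by rewrite expnS -mulnA dvdn_mulr.
Qed.

(** * Echelon form of a non-abelian subgroup *)

Section Pivots.

Variables (H : {group gT}) (sHG : H \subset G) (nabH : ~~ abelian H).

Lemma card_Frattini_quotient : #|G : 'Phi(G)| <= p ^ 3.
Proof.
have nPhi : G \subset 'N('Phi(G)) := normal_norm (Phi_normal G).
have abq := Phi_quotient_abelem pG.
rewrite -card_quotient // (card_pgroup (abelem_pgroup abq)) leq_exp2l ?prime_gt1 //.
rewrite -rank_abelem // -grank_abelian ?(abelem_abelian abq) //=.
have /= -> : G / 'Phi(G) = <<[set a1; a2; a3] / 'Phi(G)>>.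
  by rewrite -quotient_gen ?gens // -gen_subG gens.
apply: leq_trans (grank_min _) _; rewrite quotientE.
apply: leq_trans (leq_imset_card _ _) _; apply: leq_trans (subset_leq_card (subsetIr _ _)) _.
by rewrite !(setUC [set _ ; _]) !cardsU1 cards1; do 2!case: (_ \notin _).
Qed.

(** Otherwise P = Phi(G)H < P<a> < G, the last inclusion being proper by the non-generator property.
    As |G : Phi(G)| <= p^3, the quotient P / Phi(G) is then cyclic, so P is abelian, and H with
    it. *)
Lemma not_gen_Frattini a : a \in G -> H <*> <[a]> <> G -> a \in 'Phi(G) <*> H.
Proof.
move=> Ga nGHa; apply: contraR nabH => PHa.
set P := 'Phi(G) <*> H; set Q := P <*> <[a]>.
have sPhiG := Phi_sub G.
have sPG : P \subset G by rewrite join_subG sPhiG.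
have sQG : Q \subset G by rewrite join_subG sPG cycle_subG.
have nQG : #|G : Q| != 1%N.
  apply/eqP => /eqP; rewrite indexg_eq1 => sGQ; apply: nGHa.
  rewrite -[H <*> _]genGid; apply: Phi_nongen; rewrite joingA.
  by apply/eqP; rewrite eqEsubset sQG.
have nPQ : #|Q : P| != 1%N.
  by rewrite indexg_eq1 /= join_subG subxx cycle_subG.
have p_idx (A B : {group gT}) : A \subset G -> B \subset A -> p.-nat #|A : B|.
  by move=> sAG sBA; apply: pnat_dvd (dvdn_indexg _ _) (pgroupS sAG pG).
have [i iE] := p_natP (p_idx _ _ (subxx G) sQG).
have [j jE] := p_natP (p_idx _ _ sQG (joing_subl P _)).
have [k kE] := p_natP (p_idx _ _ sPG (joing_subl _ H)).
have := card_Frattini_quotient.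
rewrite -(Lagrange_index sPG (joing_subl _ _)) -(Lagrange_index sQG (joing_subl _ _)).
move: nQG nPQ; rewrite iE jE kE -!expnD leq_exp2l ?prime_gt1 //.
case: i {iE} => // i _; case: j {jE} => // j _ le3.
have le1 : k <= 1.
  by move: le3; rewrite addSn addnS !addSn !ltnS; apply/leq_trans/leq_addl.
suff : abelian P by apply: abelianS; apply: joing_subr.
apply: (@cyclic_factor_abelian _ 'Phi(G)%G).
  rewrite subsetI joing_subl /=; apply: subset_trans PhiZ _.
  by apply: subset_trans (subsetIr _ _) (centS sPG).
have nPhiP : P \subset 'N('Phi(G)) by apply: subset_trans sPG (normal_norm (Phi_normal G)).
apply: (@dvdn_prime_cyclic _ _ p) => //.
by rewrite card_quotient // kE -[X in _ %| X]expn1 dvdn_exp2l.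
Qed.

(** If p did not divide s, then a^s would generate <a>; since a^s lies in Phi(G)H, this would give
    Phi(G)H = G. *)
Lemma pivot_exponent a b s v : a \in G -> H <*> <[a]> = G -> 'Phi(G) <*> H <> G ->
  b \in 'Phi(G) <*> H -> b * a ^+ s * g v \in H -> p %| s.
Proof.
move=> Ga genHa nPH PHb Hb; apply: contraT; rewrite -prime_coprime // => cops.
case: nPH; apply/eqP; rewrite eqEsubset join_subG Phi_sub sHG /= -{1}genHa.
rewrite join_subG joing_subr cycle_subG /=.
have sHP := subsetP (joing_subr 'Phi(G) H).
have Pg : g v \in 'Phi(G) <*> H.
  apply: (subsetP (joing_subl _ _)); rewrite (Phi_joing pG).
  by apply: (subsetP (joing_subl _ _)).
have Pas : a ^+ s \in 'Phi(G) <*> H.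
  by move/sHP: Hb; rewrite groupMr // groupMl.
have : generator <[a]> (a ^+ s).
  rewrite generator_coprime; have [n ->] := p_natP (mem_p_elt pG Ga : p.-nat #[a]).
  by rewrite coprimeXl.
by move/eqP=> E; rewrite -cycle_subG E cycle_subG.
Qed.

(** The non-pivot is sought in the order a_3, a_2, a_1. Each a_i rejected on the way lies in
    Phi(G)H, which makes its exponent in the later shapes divisible by p; not all three can be
    rejected, as Phi(G)H is proper. *)
Lemma pivotP :
  [\/ exists s t v v', [/\ a1 * a3 ^+ s * g v \in H, a2 * a3 ^+ t * g v' \in H
        & H <*> <[a3]> = G],
      exists r s v v', [/\ a3 * a2 ^+ (p * r) * g v \in H, a1 * a2 ^+ s * g v' \in H
        & H <*> <[a2]> = G]
    | exists r s v v', [/\ a2 * a1 ^+ (p * r) * g v \in H,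
          a3 * a1 ^+ (p * s) * g v' \in H & H <*> <[a1]> = G]].
Proof.
have [gen3|/eqP gen3] := eqVneq (H <*> <[a3]>) G.
  have [s [v ?]] := gen_cycle_rep sHG Ga3 gen3 Ga1.
  by have [t [v' ?]] := gen_cycle_rep sHG Ga3 gen3 Ga2; apply: Or31; exists s, t, v, v'.
(* Equality would give H = G, and a_3 would have been accepted. *)
have nPH : 'Phi(G) <*> H <> G.
  move/Phi_nongen; rewrite genGid => GE; apply: gen3.
  by rewrite GE; apply/joing_idPl; rewrite cycle_subG.
have P3 := not_gen_Frattini Ga3 gen3.
have [gen2|/eqP gen2] := eqVneq (H <*> <[a2]>) G.
  have [r [v Hr]] := gen_cycle_rep sHG Ga2 gen2 Ga3.
  have [s [v' ?]] := gen_cycle_rep sHG Ga2 gen2 Ga1.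
  have /dvdnP[q E] := pivot_exponent Ga2 gen2 nPH P3 Hr.
  by apply: Or32; exists q, s, v, v'; rewrite mulnC -E.
have P2 := not_gen_Frattini Ga2 gen2.
have [gen1|/eqP gen1] := eqVneq (H <*> <[a1]>) G.
  have [r [v Hr]] := gen_cycle_rep sHG Ga1 gen1 Ga2.
  have [s [v' Hs]] := gen_cycle_rep sHG Ga1 gen1 Ga3.
  have /dvdnP[q E] := pivot_exponent Ga1 gen1 nPH P2 Hr.
  have /dvdnP[q' E'] := pivot_exponent Ga1 gen1 nPH P3 Hs.
  by apply: Or33; exists q, q', v, v'; rewrite !(mulnC p) -E -E'.
have P1 := not_gen_Frattini Ga1 gen1.
case: nPH; apply/eqP; rewrite eqEsubset join_subG Phi_sub sHG /= -{1}gens.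
by rewrite gen_subG !subUset !sub1set P1 P2.
Qed.

End Pivots.

(** * Commutators and powers of the echelon generators *)

Lemma comm_g u t v v' : u \in G -> t \in G -> [~ u * g v, t * g v'] = [~ u, t].
Proof.
move=> Gu Gt; have Gv := G'G (g_in v); have Gv' := G'G (g_in v').
rewrite class2MR // 1?groupM // (centralR (cG' (g_in v))) // 1?groupM // mulg1.
by rewrite class2RM // (central_R (cG' (g_in v'))) // mulg1.
Qed.

Lemma comm_pivot1 s t v v' :
  [~ a1 * a3 ^+ s * g v, a2 * a3 ^+ t * g v'] = g (d 3 - d 2 *+ t - d 1 *+ s)%R.
Proof.
rewrite comm_g ?groupM ?groupX // class2MR ?groupM ?groupX // !class2RM ?groupX //.
rewrite !class2XR ?groupX // !class2RX ?groupX // commgg !expg1n mulg1 !gD !gN !gMn !g_delta.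
by rewrite -!expgVn !invg_comm.
Qed.

Lemma pXn_central u n : u \in G -> u ^+ (p * n) \in 'C(G).
Proof. by move=> Gu; rewrite expgM groupX ?pX_central. Qed.

(** The exponents divisible by p leave no trace, since p-th powers are central; in the third shape
    the commutator is even constant. *)
Lemma comm_pivot2 r s v v' :
  [~ a3 * a2 ^+ (p * r) * g v, a1 * a2 ^+ s * g v'] = g (d 2 - d 1 *+ s)%R.
Proof.
rewrite comm_g ?groupM ?groupX // class2MR ?groupM ?groupX //.
rewrite (centralR (pXn_central r Ga2)) ?groupM ?groupX // mulg1.
rewrite class2RM ?groupX // class2RX // gD gN gMn !g_delta.
by rewrite -expgVn invg_comm.
Qed.

Lemma comm_pivot3 r s v v' :
  [~ a2 * a1 ^+ (p * r) * g v, a3 * a1 ^+ (p * s) * g v'] = g (d 1).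
Proof.
rewrite comm_g ?groupM ?groupX // class2MR ?groupM ?groupX //.
rewrite (centralR (pXn_central r Ga1)) ?groupM ?groupX // mulg1.
by rewrite class2RM ?groupX // (central_R (pXn_central s Ga1)) // g_delta mulg1.
Qed.

Lemma exp_pivot b a s v m : 1 < m -> a \in G -> b \in G ->
  (b * a ^+ s * g v) ^+ (p ^ m) = b ^+ (p ^ m) * a ^+ (s * p ^ m).
Proof.
move=> m1' Ga Gb; have Gv := G'G (g_in v).
rewrite expM_pX // 1?groupM ?groupX // expM_pX ?groupX // (derX _ (g_in v)) ?mulg1 ?expgM //.
by rewrite dvdn_exp // ltnW.
Qed.

(** As a^(pr) is central, no binomial correction occurs and m = 1 is allowed; m_3 and m_2 - 1 may be
    1. *)
Lemma exp_central_pivot b a r v m : 0 < m -> a \in G -> b \in G ->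
  (b * a ^+ (p * r) * g v) ^+ (p ^ m) = b ^+ (p ^ m) * a ^+ (p * r * p ^ m).
Proof.
move=> m0 Ga Gb; have Gv := G'G (g_in v).
have cb : commute b (a ^+ (p * r)).
  by apply/commute_sym/(centP (pXn_central r Ga)).
rewrite expgMn; last by apply/commute_sym/(cC (g_in v)); rewrite groupM ?groupX.
by rewrite expgMn // (derX _ (g_in v)) ?mulg1 -?expgM // dvdn_exp.
Qed.

(** The element a^(p^n) lies in G', which has exponent p. *)
Lemma exp_high a n v m s : a ^+ (p ^ n) = g v -> n < m -> a ^+ (s * p ^ m) = 1.
Proof.
move=> aE ltnm; rewrite -(subnKC ltnm) addSnnS expnD mulnCA expgM aE.
by rewrite (derX _ (g_in v)) // expnS mulnCA dvdn_mulr.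
Qed.

Lemma gs_sub_gen n (M : 'M_(n, 3)) (H : {group gT}) :
  (forall v, (v <= M)%MS -> g v \in H) -> gs M \subset H.
Proof. by move=> sMH; apply/subsetP=> _ /morphimP[v _ /[!inE] /sMH Hv ->]. Qed.

Lemma g_in_adds n1 n2 (A : 'M_(n1, 3)) (B : 'M_(n2, 3)) (H : {group gT}) :
  gs A \subset H -> gs B \subset H -> gs (A + B)%MS \subset H.
Proof.
move=> /subsetP sA /subsetP sB; apply: gs_sub_gen => _ /sub_addsmxP[[a b] /= ->].
by rewrite gD; apply: groupM; [apply: sA|apply: sB]; rewrite mem_gs submxMl.
Qed.

Lemma gs_rV v (H : {group gT}) : (gs v \subset H) = (g v \in H).
Proof.
apply/idP/idP => [/subsetP|Hv]; first by apply; rewrite mem_gs.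
by apply: gs_sub_gen => _ /sub_rVP[c ->]; rewrite gZ groupX.
Qed.

(** * From orders and ranks to bounds on the index *)

Lemma index_ge (H : {group gT}) e f : H \subset G -> #|H| <= p ^ e ->
  e + f <= m1 + m2 + m3 + 3 -> p ^ f <= #|G : H|.
Proof.
move=> sHG leH le_ef; rewrite -(@leq_pmul2l (p ^ e)) ?expn_gt0 ?prime_gt0 //.
apply: (@leq_trans #|G|); first by rewrite cardG -expnD leq_exp2l ?prime_gt1.
by rewrite -(Lagrange sHG) leq_mul2r leH orbT.
Qed.

Lemma index_le n (M : 'M_(n, 3)) (H : {group gT}) k l : H \subset G -> gs M \subset H ->
  #|G : H <*> G^`(1)| <= p ^ k -> k + 3 <= l + \rank M -> #|G : H| <= p ^ l.
Proof.
move=> sHG sMH leN le_kl; rewrite -(@leq_pmul2r (p ^ \rank M)) ?expn_gt0 ?prime_gt0 //.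
apply: (@leq_trans (#|G : H| * #|H :&: G^`(1)|)).
  by rewrite leq_mul2l -card_gs subset_leq_card ?orbT // subsetI sMH gs_sub.
rewrite index_joinD // -expnD; apply: leq_trans (_ : p ^ (k + 3) <= _).
  by rewrite expnD leq_mul2r leN orbT.
by rewrite leq_exp2l ?prime_gt1.
Qed.

Lemma index_join_pfactor (H : {group gT}) a n v : H \subset G -> a \in G ->
  H <*> <[a]> = G -> a ^+ (p ^ n) = g v ->
  exists2 k, k <= n & #|G : H <*> G^`(1)| = (p ^ k)%N.
Proof.
move=> sHG Ga genHa an.
have : a ^+ (p ^ n) \in H <*> G^`(1) by rewrite an (subsetP (joing_subr _ _)).
by rewrite (exp_in_joinD sHG Ga genHa) => /dvdn_pfactor[] // k; exists k.
Qed.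

Lemma card_gen2_gs n (M : 'M_(n, 3)) u v i j :
    u \in G -> v \in G -> [~ u, v] \in gs M ->
    u ^+ (p ^ i) \in gs M -> v ^+ (p ^ j) \in gs M ->
  #|<<[set u; v]>>| <= p ^ (i + j + \rank M).
Proof.
move=> Gu Gv Kuv Ku Kv; apply: leq_trans (subset_leq_card (joing_subl _ (gs M))) _.
rewrite !expnD -card_gs.
have cK : G \subset 'C(gs M).
  rewrite centsC; apply: subset_trans (gs_sub M) _; apply/subsetP=> c; exact: cG'.
by apply: card_gen2_central; rewrite ?expn_gt0 ?prime_gt0 ?(subsetP cK).
Qed.

Lemma pivot_vector1 s t : ((d 3 - d 2 *+ t - d 1 *+ s) 0 (ix 3) = 1)%R.
Proof. by rewrite !(mulmxnE, mxE) !ix_neq /= !eqxx !mul0rn !subr0. Qed.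

Lemma pivot_vector2 s : ((d 2 - d 1 *+ s) 0 (ix 2) = 1)%R * ((d 2 - d 1 *+ s) 0 (ix 3) = 0)%R.
Proof. by rewrite !(mulmxnE, mxE) !ix_neq /= !eqxx !mul0rn !subr0. Qed.

Lemma neq0_coord (v : 'rV['F_p]_3) j : v 0%R j != 0%R -> g v != 1.
Proof. by rewrite g_eq1; apply: contraNneq => ->; rewrite mxE. Qed.

Lemma pivot1_neq1 s t v v' : [~ a1 * a3 ^+ s * g v, a2 * a3 ^+ t * g v'] != 1.
Proof. by rewrite comm_pivot1 (@neq0_coord _ (ix 3)) ?pivot_vector1 ?oner_eq0. Qed.

Lemma pivot2_neq1 r s v v' : [~ a3 * a2 ^+ (p * r) * g v, a1 * a2 ^+ s * g v'] != 1.
Proof. by rewrite comm_pivot2 (@neq0_coord _ (ix 2)) ?pivot_vector2 ?oner_eq0. Qed.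

Lemma pivot3_neq1 r s v v' : [~ a2 * a1 ^+ (p * r) * g v, a3 * a1 ^+ (p * s) * g v'] != 1.
Proof. by rewrite comm_pivot3 (@neq0_coord _ (ix 1)) // mxE !eqxx oner_eq0. Qed.

Lemma rank_row3 (v : 'rV['F_p]_3) : \rank v <= 1.
Proof. exact: rank_leq_row. Qed.

Lemma rank_adds n1 n2 (A : 'M['F_p]_(n1, 3)) (B : 'M['F_p]_(n2, 3)) i j :
  \rank A <= i -> \rank B <= j -> \rank (A + B)%MS <= i + j.
Proof. by move=> Ai Bj; apply: leq_trans (mxrank_adds_leqif _ _) (leq_add Ai Bj). Qed.

(** * The least index of an A_1-subgroup *)

(** For each echelon shape, |H| is bounded through the orders of the two generators modulo a central
    subgroup containing their commutator. *)
Lemma A1_index_ge (H : {group gT}) : A1_subgroup G H ->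
  p ^ (m3 + 2 - \rank (w1 + w2)%MS) <= #|G : H|.
Proof.
case=> sHG A1H; set r := \rank (w1 + w2)%MS.
have r2 : r <= 2 by rewrite -[2]/(1 + 1) rank_adds ?rank_row3.
have nabH : ~~ abelian H by case: A1H.
have HG u : u \in H -> u \in G by apply: (subsetP sHG).
have lt31 := ltn_trans lt_m32 lt_m21.
have w1in (k : 'rV['F_p]_3) : (w1 <= k + (w1 + w2))%MS by rewrite submx_addr ?addsmxSl.
have w2in (k : 'rV['F_p]_3) : (w2 <= k + (w1 + w2))%MS by rewrite submx_addr ?addsmxSr.
have m2_gt0 : 0 < m2 by apply: leq_ltn_trans lt_m32.
have m2E : m2.-1.+1 = m2 by rewrite prednK.
have le3 : m3 <= m2.-1 by rewrite -ltnS m2E.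
have rankb (k : 'rV['F_p]_3) : \rank (k + (w1 + w2) + w3)%MS <= minn 3 (2 + r).
  rewrite leq_min rank_leq_col /= -[2 + r]/(1 + (1 + r)) addnC.
  by rewrite !rank_adds ?rank_row3.
have [[s [t [v [v' [Hu Hv _]]]]]|[r' [s [v [v' [Hu Hv _]]]]]|[r' [s [v [v' [Hu Hv _]]]]]]
  := pivotP sHG nabH.
- rewrite -(A1_gen2 A1H Hu Hv (pivot1_neq1 _ _ _ _)) /=.
  set k := (d 3 - d 2 *+ t - d 1 *+ s)%R.
  have leH : #|<<[set a1 * a3 ^+ s * g v; a2 * a3 ^+ t * g v']>>|
      <= p ^ (m1 + m2 + \rank (k + (w1 + w2))%MS).
    apply: card_gen2_gs; rewrite ?HG //.
    + by rewrite comm_pivot1 mem_gs addsmxSl.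
    + by rewrite exp_pivot ?(exp_high _ pow3) ?mulg1 ?pow1 ?mem_gs // (leq_ltn_trans m3_gt0).
    by rewrite exp_pivot ?(exp_high _ pow3) ?mulg1 ?pow2 ?mem_gs // (leq_ltn_trans m3_gt0).
  apply: index_ge leH _; first by rewrite gen_subG subUset !sub1set !HG.
  by apply: exponent_pivot1 => //; apply: rank_adds; rewrite ?rank_row3.
- rewrite -(A1_gen2 A1H Hu Hv (pivot2_neq1 _ _ _ _)) /=.
  (* The generator with a_3 is already raised to p^(m_2 - 1): the factor p in the exponent of a_2
     completes p^(m_2), and m_3 <= m_2 - 1. The saved factor p pays for adding w_3 to the span. *)
  set k := (d 2 - d 1 *+ s)%R.
  have leH : #|<<[set a3 * a2 ^+ (p * r') * g v; a1 * a2 ^+ s * g v']>>|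
      <= p ^ (m2.-1 + m1 + \rank (k + (w1 + w2) + w3)%MS).
    apply: card_gen2_gs; rewrite ?HG //.
    + by rewrite comm_pivot2 mem_gs -addsmxA addsmxSl.
    + rewrite exp_central_pivot ?(leq_trans m3_gt0) //.
      rewrite mulnAC -expnS m2E expgM pow2 -(subnKC le3) expnD expgM pow3.
      by apply: groupM; apply: groupX; rewrite mem_gs ?addsmxSr // submx_addl.
    rewrite exp_pivot ?(exp_high _ pow2) ?mulg1 ?pow1 ?mem_gs 1?submx_addl //.
    by rewrite (leq_ltn_trans m3_gt0).
  apply: index_ge leH _; first by rewrite gen_subG subUset !sub1set !HG.
  exact: exponent_pivot2 (rankb k).
rewrite -(A1_gen2 A1H Hu Hv (pivot3_neq1 _ _ _ _)) /=.
set M := (d 1 + (w1 + w2) + w3)%MS.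
(* The a_1-parts of the p^(m_2)-th and p^(m_3)-th powers of the generators are powers of c, so K has
   to contain c besides G'-elements. The generator 1 in K makes [card_gen2_central] applicable to
   |K|. *)
set c := a1 ^+ (p ^ m3.+1).
pose K := (<<[set c; 1%g]>> <*> gs M)%G.
have sKG : K \subset G.
  by rewrite join_subG gen_subG subUset !sub1set groupX // group1 (subset_trans (gs_sub M)) ?der_sub.
have cGgs : G \subset 'C(gs M).
  by rewrite centsC; apply: subset_trans (gs_sub M) _; apply/subsetP=> u; apply: cG'.
have cc : c \in 'C(G) by rewrite /c expnS pXn_central.
have cGK : G \subset 'C(K).
  by rewrite centsC join_subG gen_subG subUset !sub1set cc group1 centsC.
have leK : #|K| <= p ^ (m1 - m3.+1 + \rank M).
  rewrite expnD -card_gs -[(p ^ (m1 - _))%N]muln1; apply: card_gen2_central.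
  + by rewrite expn_gt0 prime_gt0.
  + by [].
  + by rewrite (subsetP cGgs) ?groupX.
  + exact: group1.
  + by rewrite commg1 group1.
  + by rewrite -expgM -expnD subnKC // pow1 mem_gs submx_addl.
  exact: group1.
have gsK : gs M \subset K by apply: joing_subr.
have cK n : c ^+ n \in K.
  by rewrite groupX // (subsetP (joing_subl _ _)) // mem_gen // !inE eqxx.
have gK u : (u <= M)%MS -> g u \in K by move=> ?; rewrite (subsetP gsK) ?mem_gs.
have leH : #|<<[set a2 * a1 ^+ (p * r') * g v; a3 * a1 ^+ (p * s) * g v']>>|
    <= p ^ m2 * p ^ m3 * #|K|.
  apply: leq_trans (subset_leq_card (joing_subl _ K)) _.
  apply: card_gen2_central; rewrite ?expn_gt0 ?prime_gt0 ?(subsetP cGK) ?HG //.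
  - by rewrite comm_pivot3 gK // /M submx_addl ?addsmxSl.
  - rewrite exp_central_pivot // pow2 groupM ?gK 1?submx_addl //.
    by rewrite mulnAC -expnS -(subnKC (ltnW lt_m32)) -addSn expnD -mulnA expgM cK.
  rewrite exp_central_pivot // pow3 groupM ?gK 1?submx_addr //.
  by rewrite mulnAC -expnS expgM cK.
have {}leH := leq_trans leH (leq_mul (leqnn _) leK).
rewrite -!expnD in leH; apply: index_ge leH _; first by rewrite gen_subG subUset !sub1set !HG.
by apply: exponent_pivot3 => //; apply: rankb.
Qed.

Lemma A1_pair u v : u \in G -> v \in G -> [~ u, v] != 1 -> A1_subgroup G <<[set u; v]>>.
Proof.
move=> Gu Gv ncuv; split; last exact: gen2_A1 p_pr pG PhiZ Gu Gv ncuv.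
by rewrite gen_subG subUset !sub1set Gu.
Qed.

Lemma delta_full n (A : 'M['F_p]_(n, 3)) :
  (d 1 <= A)%MS -> (d 2 <= A)%MS -> (d 3 <= A)%MS -> \rank A = 3.
Proof.
move=> A1 A2 A3; apply/eqP; rewrite -[_ == _]/(row_full A) -sub1mx.
by apply/row_subP; apply: ix_cases; rewrite rowE mulmx1.
Qed.

(* The vectors (0,0,1), (-1,0,1), (0,-1,1) span everything, so one of them is outside <w1, w2>. *)
Lemma exists_A1_index_le :
  exists2 H : {group gT}, A1_subgroup G H & #|G : H| <= p ^ (m3 + 2 - \rank (w1 + w2)%MS).
Proof.
set W := (w1 + w2)%MS.
have r2 : \rank W <= 2 by rewrite -[2]/(1 + 1) rank_adds ?rank_row3.
have [s [t kW]] : exists s t, ~~ ((d 3 - d 2 *+ t - d 1 *+ s)%R <= W)%MS.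
  have [h00|h00] := boolP ((d 3 - d 2 *+ 0 - d 1 *+ 0)%R <= W)%MS; last by exists 0%N, 0%N.
  have [h10|h10] := boolP ((d 3 - d 2 *+ 0 - d 1 *+ 1)%R <= W)%MS; last by exists 1%N, 0%N.
  have [h01|h01] := boolP ((d 3 - d 2 *+ 1 - d 1 *+ 0)%R <= W)%MS; last by exists 0%N, 1%N.
  rewrite !mulr0n !mulr1n !subr0 in h00 h10 h01.
  suff E : \rank W = 3 by rewrite E in r2.
  apply: delta_full => //.
    by rewrite -[d 1](subKr (d 3)) addmx_sub ?eqmx_opp.
  by rewrite -[d 2](subKr (d 3)) addmx_sub ?eqmx_opp.
have nk := pivot1_neq1 s t 0%R 0%R.
set u := a1 * a3 ^+ s * g 0%R in nk; set v := a2 * a3 ^+ t * g 0%R in nk.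
have Gu : u \in G by apply: groupM; [rewrite groupM ?groupX | apply: G'G].
have Gv : v \in G by apply: groupM; [rewrite groupM ?groupX | apply: G'G].
have A1H := A1_pair Gu Gv nk; exists <<[set u; v]>>%G => //.
set H := <<[set u; v]>>%G in A1H *; have [sHG _] := A1H.
have Hu : u \in H by apply: mem_gen; rewrite !inE eqxx.
have Hv : v \in H by apply: mem_gen; rewrite !inE eqxx orbT.
have sMH : gs ((d 3 - d 2 *+ t - d 1 *+ s)%R + W)%MS \subset H.
  rewrite !g_in_adds // gs_rV.
  - by rewrite -(comm_pivot1 s t 0%R 0%R) groupR.
  - by rewrite -pow1 -[a1 ^+ _]mulg1 -(exp_high s pow3 (ltn_trans lt_m32 lt_m21))
      -(exp_pivot s 0%R) ?groupX // (leq_ltn_trans m3_gt0) // (ltn_trans lt_m32).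
  by rewrite -pow2 -[a2 ^+ _]mulg1 -(exp_high t pow3 lt_m32) -(exp_pivot t 0%R)
    ?groupX // (leq_ltn_trans m3_gt0).
(* Multiplying u and v by powers of a_3 recovers a_1 and a_2. *)
have gen3 : H <*> <[a3]> = G.
  set L := H <*> <[a3]>.
  have La3 : a3 \in L by rewrite -cycle_subG joing_subr.
  have sHL := subsetP (joing_subl H <[a3]>).
  have g0 : g 0%R = 1 by apply/eqP; rewrite g_eq1.
  apply/eqP; rewrite eqEsubset join_subG sHG cycle_subG Ga3 -{1}gens gen_subG !subUset !sub1set La3.
  have := sHL _ Hu; have := sHL _ Hv; rewrite /u /v g0 !mulg1.
  by rewrite !(groupMr _ (groupX _ La3)) => -> ->.
have [k lek kE] := index_join_pfactor sHG Ga3 gen3 pow3.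
apply: (index_le sHG sMH (k := m3)); first by rewrite kE leq_exp2l ?prime_gt1.
(* The commutator lies outside W, so it adds one to the rank found in H \cap G'. *)
have : \rank W < \rank ((d 3 - d 2 *+ t - d 1 *+ s)%R + W)%MS.
  by rewrite rank_ltmx // ltmxE addsmxSr addsmx_sub submx_refl andbT.
exact: exponent_rank_succ.
Qed.

(** * The largest index of an A_1-subgroup *)

(** The witness <a_2, a_3> leaves out the generator of largest order modulo G'. *)
Lemma exists_A1_index_ge23 :
  exists2 H : {group gT}, A1_subgroup G H & p ^ (m1 + 3 - \rank (d 1 + (w2 + w3))%MS) <= #|G : H|.
Proof.
have nk : [~ a2, a3] != 1.
  by rewrite -g_delta (@neq0_coord _ (ix 1)) // mxE !eqxx oner_eq0.
have A1H := A1_pair Ga2 Ga3 nk; exists <<[set a2; a3]>>%G => //.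
have [sHG _] := A1H; set M := (_ + _)%MS.
have leH : #|<<[set a2; a3]>>| <= p ^ (m2 + m3 + \rank M).
  apply: card_gen2_gs => //; rewrite -?g_delta ?pow2 ?pow3 mem_gs /M ?addsmxSl //.
    by rewrite submx_addr ?addsmxSl.
  by rewrite submx_addr ?addsmxSr.
apply: index_ge sHG leH _.
exact: exponent_pair23 (rank_leq_col M).
Qed.

(** The witness <a_3, a_1> is for (B18), where d_2, w_1, w_3 have rank 1 while d_1, w_2, w_3 have
    rank 3; if m_1 = m_2 + 1, the gain in rank outweighs the loss from m_1 to m_2. *)
Lemma exists_A1_index_ge31 :
  exists2 H : {group gT}, A1_subgroup G H & p ^ (m2 + 3 - \rank (d 2 + (w1 + w3))%MS) <= #|G : H|.
Proof.
have nk : [~ a3, a1] != 1.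
  by rewrite -g_delta (@neq0_coord _ (ix 2)) // mxE !eqxx oner_eq0.
have A1H := A1_pair Ga3 Ga1 nk; exists <<[set a3; a1]>>%G => //.
have [sHG _] := A1H; set M := (_ + _)%MS.
have leH : #|<<[set a3; a1]>>| <= p ^ (m3 + m1 + \rank M).
  apply: card_gen2_gs => //; rewrite -?g_delta ?pow1 ?pow3 mem_gs /M ?addsmxSl //.
    by rewrite submx_addr ?addsmxSr.
  by rewrite submx_addr ?addsmxSl.
apply: index_ge sHG leH _.
exact: exponent_pair31 (rank_leq_col M).
Qed.

(** A nontrivial commutator already gives H \cap G' rank at least 1. *)
Lemma A1_index_le2 (H : {group gT}) k : H \subset G -> A1_group H ->
  #|G : H <*> G^`(1)| <= p ^ k -> #|G : H| <= p ^ (k + 2).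
Proof.
move=> sHG A1H lek.
have [u [v [Hu Hv ncuv]]] := A1_noncomm A1H.
have [x xE] := g_surj (R (subsetP sHG _ Hu) (subsetP sHG _ Hv)).
have Mx : gs x \subset H by rewrite gs_rV -xE groupR.
by apply: (index_le sHG Mx lek); rewrite rank_rV -g_eq1 -xE ncuv -addnA.
Qed.

Lemma pivot_exp_in (H : {group gT}) a b n r v x : 0 < n -> a \in G -> b \in G ->
  b ^+ (p ^ n) = g x -> b * a ^+ (p * r) * g v \in H ->
  g x * a ^+ (p * r * p ^ n) \in H.
Proof. by move=> n0 Ga Gb bE Hb; rewrite -bE -(exp_central_pivot r v) // groupX. Qed.

Lemma gen_cycle_dvd (H : {group gT}) a x n : H \subset G -> a \in G -> H <*> <[a]> = G ->
  g x * a ^+ n \in H -> #|G : H <*> G^`(1)| %| n.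
Proof.
move=> sHG Ga genHa Hx; rewrite -(exp_in_joinD sHG Ga genHa).
have Ng : g x \in H <*> G^`(1) by apply: (subsetP (joing_subr _ _)).
by rewrite -(groupMl _ Ng) (subsetP (joing_subl _ _)).
Qed.

(** When p^m divides n, the factor a^n is itself in G', so the product is an explicit element of H
    \cap G'. *)
Lemma gen_cycle_in (H : {group gT}) a x y m n : a ^+ (p ^ m) = g y -> p ^ m %| n ->
  g x * a ^+ n \in H -> exists c, g (x + y *+ c)%R \in H.
Proof.
move=> aE /dvdnP[c ->] Hx; exists c.
by rewrite gD gMn -aE -expgM mulnC.
Qed.

(** If |G : HG'| < p^(m_1), [A1_index_le2] suffices. Otherwise a_1 is the non-pivot and H \cap G'
    contains d_1 and some w_2 + c w_1 or w_3 + c w_1; the column j, where w_1 and d_1 vanish, shows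
    that these are independent. *)
Lemma A1_index_le1 (H : {group gT}) j : A1_subgroup G H -> j != ix 1 ->
  w1 0%R j = 0%R -> (w2 0%R j != 0%R) || (w3 0%R j != 0%R) -> #|G : H| <= p ^ m1.+1.
Proof.
case=> sHG A1H j1 w1j wj; have nabH : ~~ abelian H by case: A1H.
have lt_pX i k : i <= k -> p ^ i <= p ^ k by move=> ?; rewrite leq_exp2l ?prime_gt1.
have small k : k < m1 -> #|G : H <*> G^`(1)| <= p ^ k -> #|G : H| <= p ^ m1.+1.
  move=> ltk lek; apply: leq_trans (A1_index_le2 sHG A1H lek) (lt_pX _ _ _).
  by rewrite addn2.
have d1j : d 1 0%R j = 0%R by rewrite mxE (negPf j1) andbF.
have d1nz : d 1 != 0%R by apply/eqP => /rowP/(_ (ix 1))/eqP; rewrite !mxE !eqxx oner_eq0.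
have [[s [t [v [v' [Hu Hv gen]]]]]|[r' [s [v [v' [Hu Hv gen]]]]]|[r' [s [v [v' [Hu Hv gen]]]]]]
  := pivotP sHG nabH.
- have [k lek kE] := index_join_pfactor sHG Ga3 gen pow3.
  by apply: (small k); rewrite ?kE // (leq_ltn_trans lek) // (ltn_trans lt_m32).
- have [k lek kE] := index_join_pfactor sHG Ga2 gen pow2.
  by apply: (small k); rewrite ?kE // (leq_ltn_trans lek).
have [k lek kE] := index_join_pfactor sHG Ga1 gen pow1.
have [ltk|gek] := ltnP k m1; first by apply: (small k); rewrite ?kE.
have {k lek gek} kE : #|G : H <*> G^`(1)| = (p ^ m1)%N.
  by rewrite kE; congr (p ^ _)%N; apply/eqP; rewrite eqn_leq lek.
have H1 : g (d 1) \in H by rewrite -(comm_pivot3 r' s v v') groupR.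
have H2 := pivot_exp_in (leq_ltn_trans (leq0n m3) lt_m32) Ga1 Ga2 pow2 Hu.
have H3 := pivot_exp_in m3_gt0 Ga1 Ga3 pow3 Hv.
(* Full index p^(m_1) forces the a_1-exponents to be multiples of p^(m_1). *)
have dv2 := gen_cycle_dvd sHG Ga1 gen H2; have dv3 := gen_cycle_dvd sHG Ga1 gen H3.
rewrite kE in dv2 dv3.
have [x Hx xj] : exists2 x, g x \in H & x 0%R j != 0%R.
  have [w2j|w2j] := boolP (w2 0%R j != 0%R).
    have [c Hc] := gen_cycle_in pow1 dv2 H2; exists (w2 + w1 *+ c)%R => //.
    by rewrite mxE mulmxnE w1j mul0rn addr0.
  have [c Hc] := gen_cycle_in pow1 dv3 H3; exists (w3 + w1 *+ c)%R => //.
  by rewrite mxE mulmxnE w1j mul0rn addr0; move: wj; rewrite (negPf w2j).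
have sM : gs (d 1 + x)%MS \subset H by rewrite g_in_adds ?gs_rV.
apply: (index_le sHG sM (k := m1)); first by rewrite kE.
by rewrite addSn -addnS leq_add2l ltnS (rank_adds_coord d1nz d1j xj).
Qed.

(** With |G : HG'| = p^k, the rank of H \cap G' has to be at least k + 3 - m_1: three for k = m_1,
    two for k = m_1 - 1, and one, which is automatic, for smaller k. *)
Lemma A1_index_le0 (H : {group gT}) : A1_subgroup G H ->
    \rank (d 1 + (w2 + w3))%MS = 3 -> (w1 <= d 1)%MS ->
    [\/ m2.+1 < m1, w1 != 0%R | w2 0%R (ix 3) = 0%R /\ w3 0%R (ix 3) != 0%R] ->
  #|G : H| <= p ^ m1.
Proof.
case=> sHG A1H rank3 w1d1 cond2; have nabH : ~~ abelian H by case: A1H.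
have small k : k.+1 < m1 -> #|G : H <*> G^`(1)| <= p ^ k -> #|G : H| <= p ^ m1.
  move=> ltk lek; apply: leq_trans (A1_index_le2 sHG A1H lek) _.
  by rewrite leq_exp2l ?prime_gt1 // addn2.
have m2_gt0 : 0 < m2 by apply: leq_ltn_trans lt_m32.
have d1nz : d 1 != 0%R by apply/eqP => /rowP/(_ (ix 1))/eqP; rewrite !mxE !eqxx oner_eq0.
have [[s [t [v [v' [Hu Hv gen]]]]]|[r' [s [v [v' [Hu Hv gen]]]]]|[r' [s [v [v' [Hu Hv gen]]]]]]
  := pivotP sHG nabH.
- have [k lek kE] := index_join_pfactor sHG Ga3 gen pow3.
  by apply: (small k); rewrite ?kE // (leq_trans _ lt_m21) // !ltnS (leq_ltn_trans lek).
- have [k lek kE] := index_join_pfactor sHG Ga2 gen pow2.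
  have [ltk|] := ltnP k.+1 m1; first by apply: (small k); rewrite ?kE.
  (* The non-pivot a_2 is critical only for k = m_2 = m_1 - 1. A second vector beside the commutator
     is then w_1, or w_3 + c w_2, according to the last hypothesis. *)
  move=> gek; have kE2 : k = m2 by apply/eqP; rewrite eqn_leq lek -ltnS (leq_trans lt_m21 gek).
  have m1E : m1 = m2.+1 by apply/eqP; rewrite eqn_leq lt_m21 (leq_trans gek).
  rewrite {}kE2 in kE lek gek.
  set kv := (d 2 - d 1 *+ s)%R.
  have Hk : g kv \in H by rewrite -(comm_pivot2 r' s v v') groupR.
  suff [x Hx rkx] : exists2 x, g x \in H & 1 < \rank (kv + x)%MS.
    have sM : gs (kv + x)%MS \subset H by rewrite g_in_adds ?gs_rV.
    by apply: (index_le sHG sM (k := m2)); rewrite ?kE // m1E addSn -addnS leq_add2l ltnS.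
  case: cond2 => [|w1nz|[w2z w3nz]]; first by rewrite m1E ltnn.
    exists w1.
      have /(groupX (p ^ m1)) := Hv.
      by rewrite exp_pivot ?(exp_high _ pow2) ?mulg1 ?pow1 // (leq_trans _ lt_m21).
    rewrite addsmxC (@rank_adds_coord _ _ _ _ (ix 2)) //.
      by case/sub_rVP: w1d1 => c ->; rewrite !mxE ix_neq mulr0.
    by rewrite pivot_vector2 oner_eq0.
  have H2 := pivot_exp_in m3_gt0 Ga2 Ga3 pow3 Hu.
  have dv2 := gen_cycle_dvd sHG Ga2 gen H2; rewrite kE in dv2.
  have [c Hc] := gen_cycle_in pow2 dv2 H2; exists (w3 + w2 *+ c)%R => //.
  apply: (@rank_adds_coord _ _ _ _ (ix 3)); rewrite ?pivot_vector2 //.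
    by apply/eqP => /rowP/(_ (ix 2))/eqP; rewrite pivot_vector2 mxE oner_eq0.
  by rewrite mxE mulmxnE w2z mul0rn addr0.
have [k lek kE] := index_join_pfactor sHG Ga1 gen pow1.
have H1 : g (d 1) \in H by rewrite -(comm_pivot3 r' s v v') groupR.
have H2 := pivot_exp_in m2_gt0 Ga1 Ga2 pow2 Hu.
have H3 := pivot_exp_in m3_gt0 Ga1 Ga3 pow3 Hv.
have dv2 := gen_cycle_dvd sHG Ga1 gen H2; have dv3 := gen_cycle_dvd sHG Ga1 gen H3.
have [ltk|gek] := ltnP k.+1 m1; first by apply: (small k); rewrite ?kE.
rewrite kE in dv2 dv3.
have w1c (x : 'rV['F_p]_3) c : ((x + w1 *+ c)%R <= d 1)%MS -> (x <= d 1)%MS.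
  move=> xd; rewrite -[x](addrK (w1 *+ c)%R) addmx_sub // eqmx_opp.
  by rewrite -scaler_nat scalemx_sub.
have nw2 : ~~ (w2 <= d 1 + w3)%MS.
  apply: contraTN (eq_leq (esym rank3)) => w2d; rewrite -leqNgt.
  apply: leq_trans (mxrankS _) (rank_adds (rank_row3 (d 1)) (rank_row3 w3)).
  by rewrite !addsmx_sub w2d addsmxSl addsmxSr.
have nw3 : ~~ (w3 <= d 1 + w2)%MS.
  apply: contraTN (eq_leq (esym rank3)) => w3d; rewrite -leqNgt.
  apply: leq_trans (mxrankS _) (rank_adds (rank_row3 (d 1)) (rank_row3 w2)).
  by rewrite !addsmx_sub w3d addsmxSl addsmxSr.
(* For k = m_1 both powers give elements of G', congruent to w_2 and w_3 modulo d_1, hence rank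
   3. *)
have [km1|ltk] := eqVneq k m1.
  rewrite km1 in kE dv2 dv3.
  have [c Hc] := gen_cycle_in pow1 dv2 H2; have [c' Hc'] := gen_cycle_in pow1 dv3 H3.
  set x := (w2 + w1 *+ c)%R in Hc; set y := (w3 + w1 *+ c')%R in Hc'.
  have sM : gs (d 1 + (x + y))%MS \subset H by rewrite !g_in_adds ?gs_rV.
  apply: (index_le sHG sM (k := m1)); rewrite ?kE // leq_add2l -[X in X <= _]rank3 mxrankS //.
  have w1M (z : 'rV['F_p]_3) e : ((z + w1 *+ e)%R <= d 1 + (x + y))%MS -> (z <= d 1 + (x + y))%MS.
    move=> zM; rewrite -[z](addrK (w1 *+ e)%R) addmx_sub // eqmx_opp.
    by rewrite -scaler_nat scalemx_sub // submx_addl.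
  rewrite !addsmx_sub addsmxSl (w1M w2 c) ?(w1M w3 c') //.
    by rewrite submx_addr ?addsmxSr.
  by rewrite submx_addr ?addsmxSl.
have m1E : m1 = k.+1 by apply/eqP; rewrite eqn_leq gek ltn_neqAle ltk.
suff [x Hx xd] : exists2 x, g x \in H & ~~ (x <= d 1)%MS.
  have sM : gs (d 1 + x)%MS \subset H by rewrite g_in_adds ?gs_rV.
  apply: (index_le sHG sM (k := k)); rewrite ?kE // m1E addSn -addnS leq_add2l ltnS.
  exact: rank_adds_row.
(* For k = m_1 - 1 one vector outside the line of d_1 is enough; A and B are the a_1-exponents
   divided by p^k. *)
case/dvdnP: dv2 => A AE; case/dvdnP: dv3 => B BE; rewrite AE BE in H2 H3.
have [pA|npA] := boolP (p %| A).
  have dv : p ^ m1 %| A * p ^ k by rewrite m1E expnS dvdn_mul.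
  have [c Hc] := gen_cycle_in pow1 dv H2; exists (w2 + w1 *+ c)%R => //.
  by apply: contra nw2 => /w1c; apply: submx_addl.
(* (u^{p^{m2}})^i (v^{p^{m3}})^A, whose a_1-exponent is divisible by p^{m1}, lies in G'. *)
set i := (B * p.-1)%N; set x := (w2 *+ i + w3 *+ A)%R.
have dv : p ^ m1 %| (A * p ^ k * i + B * p ^ k * A)%N.
  (* The choice of i, which is -B modulo p, makes A i + B A equal to p A B. *)
  rewrite m1E (_ : (_ + _)%N = (A * B * (p.-1.+1 * p ^ k))%N).
    by rewrite prednK ?prime_gt0 // -expnS dvdn_mull.
  rewrite /i mulSn mulnDr addnC; congr (_ + _)%N; first by rewrite mulnAC (mulnC B).
  by rewrite mulnACA [(p ^ k * _)%N]mulnC.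
have Hxa : g x * a1 ^+ (A * p ^ k * i + B * p ^ k * A) \in H.
  have := groupM (groupX i H2) (groupX A H3).
  have cg u n : commute (g u) (a1 ^+ n) by apply: cC; rewrite ?groupX.
  rewrite !(expgMn _ (cg _ _)) -!expgM -!gMn -mulgA (mulgA (a1 ^+ _)) -(cg _ _).
  by rewrite -(mulgA (g _)) mulgA -gD -expgD.
have [c Hc] := gen_cycle_in pow1 dv Hxa; exists (x + w1 *+ c)%R => //.
(* As p does not divide A, w_3 would be a combination of d_1 and w_2. *)
apply: contra nw3 => /w1c xd.
have nzA : (A%:R : 'F_p)%R != 0%R by rewrite -(dvdn_pcharf (pchar_Fp p_pr)).
rewrite -(eqmx_scale w3 nzA) scaler_nat.
rewrite (_ : w3 *+ A = x - w2 *+ i)%R; last by rewrite /x addrC addKr.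
apply: addmx_sub; first exact: submx_addl.
by rewrite eqmx_opp -scaler_nat scalemx_sub ?addsmxSr.
Qed.

(** * The bounds restated for I_min and I_max *)

Lemma Imin_rank I : is_Imin p G I -> I = (m3 + 2 - \rank (w1 + w2)%MS)%N.
Proof.
case=> [[H A1H HE] minI]; apply/eqP; rewrite eqn_leq; apply/andP; split.
  have [L A1L leL] := exists_A1_index_le.
  by rewrite -(leq_exp2l _ _ (prime_gt1 p_pr)) (leq_trans (minI _ A1L)).
by rewrite -(leq_exp2l _ _ (prime_gt1 p_pr)) -HE A1_index_ge.
Qed.

Lemma Imax_ge23 I : is_Imax p G I -> m1 + 3 - \rank (d 1 + (w2 + w3))%MS <= I.
Proof.
case=> _ maxI; have [L A1L leL] := exists_A1_index_ge23.
by rewrite -(leq_exp2l _ _ (prime_gt1 p_pr)) (leq_trans leL) ?maxI.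
Qed.

Lemma Imax_ge31 I : is_Imax p G I -> m2 + 3 - \rank (d 2 + (w1 + w3))%MS <= I.
Proof.
case=> _ maxI; have [L A1L leL] := exists_A1_index_ge31.
by rewrite -(leq_exp2l _ _ (prime_gt1 p_pr)) (leq_trans leL) ?maxI.
Qed.

Lemma Imax_le1 I j : is_Imax p G I -> j != ix 1 ->
  w1 0%R j = 0%R -> (w2 0%R j != 0%R) || (w3 0%R j != 0%R) -> I <= m1.+1.
Proof.
case=> [[H A1H HE] _] j1 w1j wj.
by rewrite -(leq_exp2l _ _ (prime_gt1 p_pr)) -HE (A1_index_le1 A1H j1).
Qed.

Lemma Imax_le0 I : is_Imax p G I ->
    \rank (d 1 + (w2 + w3))%MS = 3 -> (w1 <= d 1)%MS ->
    [\/ m2.+1 < m1, w1 != 0%R | w2 0%R (ix 3) = 0%R /\ w3 0%R (ix 3) != 0%R] ->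
  I <= m1.
Proof.
case=> [[H A1H HE] _] rk3 w1d1 cond.
by rewrite -(leq_exp2l _ _ (prime_gt1 p_pr)) -HE A1_index_le0.
Qed.

End ThreeGenerators.

(** * Ranks of the listed matrices *)

Section Matrices.

Variables (p : nat) (p_pr : prime p) (eta : 'F_p).
Hypothesis eta_nonres : odd p -> nonresidue eta.

Local Open Scope ring_scope.

Local Notation d j := (delta_mx 0 (ix j) : 'rV['F_p]_3).
Local Notation r w i := (row (ix i) w : 'rV['F_p]_3).

(** A non-residue is nonzero because 0 is a square. *)
Lemma nu_range_neq0 (nu : 'F_p) : nu_range eta nu -> nu != 0.
Proof.
case=> [->|[/eta_nonres nonres ->]]; first exact: oner_neq0.
by apply/eqP => eta0; case: (nonres 0); rewrite eta0 expr2 mulr0.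
Qed.

Lemma row_e i a b : r (e a b) i = (ix i == ix a)%:R *: d b.
Proof. by apply/rowP=> k; rewrite !mxE eqxx mulr_natl -mulnb natrM mulr_natl. Qed.

Lemma row_scale_e i c a b : r (c *: e a b) i = ((ix i == ix a)%:R * c) *: d b.
Proof. by rewrite linearZ /= row_e scalerA mulrC. Qed.

Lemma delta_neq0 j : d j != 0.
Proof. by apply/eqP => /rowP/(_ (ix j))/eqP; rewrite !mxE !eqxx oner_eq0. Qed.

Lemma rank_delta1 a c : c != 0 -> \rank (c *: d a)%MS = 1%N.
Proof. by move=> nzc; rewrite rank_rV scaler_eq0 negb_or nzc delta_neq0. Qed.

Lemma rank_delta2 a b c c' : ix a != ix b -> c != 0 -> c' != 0 ->
  \rank (c *: d a + c' *: d b)%MS = 2%N.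
Proof.
move=> ab nzc nzc'; apply/eqP; rewrite eqn_leq -[2%N]/(1 + 1)%N rank_adds ?rank_row3 //=.
apply: (@rank_adds_coord _ _ _ _ (ix b)).
- by rewrite scaler_eq0 negb_or nzc delta_neq0.
- by rewrite !mxE eqxx (eq_sym (ix b)) (negPf ab) mulr0.
by rewrite !mxE !eqxx mulr1.
Qed.

Definition row_simpl := (row_e, row_scale_e, ix_neq, eqxx, mulr0n, mulr1n, mul0r, mul1r,
  scale0r, addr0, add0r).

(** Every row of a listed matrix is a multiple of a unit vector. The tactic enumerates the index (20
    splittings exceed the maximum 18), keeps the nonvanishing of the parameters as [h2] and [h3],
    and exposes the rows in that form. *)
Ltac matrix_cases :=
  let k := fresh "k" in case=> k; do 20?[case: k => [|k] //]; move=> _ /=;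
  try (case=> nu1 [nu2 [/nu_range_neq0 h2 /nu_range_neq0 h3 ->]]);
  try (case=> t /nu_range_neq0 h2 ->); try (case=> t h2 ->); try move->;
  rewrite ?linearD /= ?linear0 ?row_simpl.

(** The three groups are those where w_1, w_2 have rank 2, 1 and 0. *)
Lemma listed_Imin (w : 'M['F_p]_3) : inA eta 1 6 w \/ inB eta 1 18 w \/ inC 1 10 w ->
  [\/ inA eta 1 6 w \/ inB eta 1 4 w \/ inB eta 15 16 w,
      inB eta 5 14 w \/ inB eta 17 18 w \/ inC 1 6 w | inC 7 10 w].
Proof.
case=> [hA|[[k lek hB]|[k lek hC]]]; first by apply: Or31; left.
  have [le4|gt4] := leqP k 4; first by apply: Or31; right; left; exists k => //; case/andP: lek => ->.
  have [le14|gt14] := leqP k 14; first by apply: Or32; left; exists k; rewrite ?gt4.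
  have [le16|gt16] := leqP k 16; first by apply: Or31; right; right; exists k; rewrite ?gt14.
  by apply: Or32; right; left; exists k => //; case/andP: lek => _ ->; rewrite ?gt16.
have [le6|gt6] := leqP k 6; first by apply: Or32; right; right; exists k => //; case/andP: lek => ->.
by apply: Or33; exists k => //; case/andP: lek => _ ->; rewrite ?gt6.
Qed.

(** The grouping follows the rank of d_1, w_2, w_3; (B18) stands alone because its I_max depends on
    m_1 - m_2. *)
Lemma listed_Imax (w : 'M['F_p]_3) : inA eta 1 6 w \/ inB eta 1 18 w \/ inC 1 10 w ->
  [\/ inB eta 13 16 w \/ inC 1 4 w \/ inC 9 10 w,
      inA eta 3 6 w \/ inB eta 1 12 w \/ inC 5 8 w,
      inA eta 1 2 w \/ inB eta 17 17 w | inB eta 18 18 w].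
Proof.
case=> [[k lek hA]|[[k lek hB]|[k lek hC]]].
- have [le2|gt2] := leqP k 2; first by apply: Or43; left; exists k => //; case/andP: lek => ->.
  by apply: Or42; left; exists k => //; case/andP: lek => _ ->; rewrite ?gt2.
- have [le12|gt12] := leqP k 12.
    by apply: Or42; right; left; exists k => //; case/andP: lek => ->.
  have [le16|gt16] := leqP k 16; first by apply: Or41; left; exists k; rewrite ?gt12.
  have [le17|gt17] := leqP k 17; first by apply: Or43; right; exists k; rewrite ?gt16.
  by apply: Or44; exists k => //; case/andP: lek => _ ->; rewrite ?gt17.
have [le4|gt4] := leqP k 4; first by apply: Or41; right; left; exists k => //; case/andP: lek => ->.
have [le8|gt8] := leqP k 8; first by apply: Or42; right; right; exists k; rewrite ?gt4.
by apply: Or41; right; right; exists k => //; case/andP: lek => _ ->; rewrite ?gt8.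
Qed.

Let h1 : (1 : 'F_p) != 0 := oner_neq0 _.

Lemma rank12_eq2 (w : 'M['F_p]_3) : inA eta 1 6 w \/ inB eta 1 4 w \/ inB eta 15 16 w ->
  \rank (r w 1 + r w 2)%MS = 2%N.
Proof. by case=> [|[]]; matrix_cases; apply: rank_delta2; rewrite ?ix_neq. Qed.

Lemma rank12_eq1 (w : 'M['F_p]_3) : inB eta 5 14 w \/ inB eta 17 18 w \/ inC 1 6 w ->
  \rank (r w 1 + r w 2)%MS = 1%N.
Proof. by case=> [|[]]; matrix_cases; rewrite ?adds0mx ?addsmx0 rank_delta1. Qed.

Lemma rank12_eq0 (w : 'M['F_p]_3) : inC 7 10 w -> \rank (r w 1 + r w 2)%MS = 0%N.
Proof. by matrix_cases; rewrite adds0mx mxrank0. Qed.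

Lemma rank123_le1 (w : 'M['F_p]_3) : inB eta 13 16 w \/ inC 1 4 w \/ inC 9 10 w ->
  (\rank (d 1 + (r w 2 + r w 3))%MS <= 1)%N.
Proof.
suff wd : (r w 2 <= d 1)%MS -> (r w 3 <= d 1)%MS -> (\rank (d 1 + (r w 2 + r w 3))%MS <= 1)%N.
  by case=> [|[]] lw; apply: wd; move: lw; matrix_cases; rewrite ?sub0mx ?scalemx_sub.
move=> w2d w3d; apply: leq_trans (mxrankS _) (rank_row3 (d 1)).
by rewrite !addsmx_sub w2d w3d submx_refl.
Qed.

(** In each of these matrices w_2 or w_3 is a multiple of d_1. *)
Lemma rank123_le2 (w : 'M['F_p]_3) : inA eta 3 6 w \/ inB eta 1 12 w \/ inC 5 8 w ->
  (\rank (d 1 + (r w 2 + r w 3))%MS <= 2)%N.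
Proof.
move=> lw; suff /orP[wd|wd] : (r w 2 <= d 1)%MS || (r w 3 <= d 1)%MS.
- apply: leq_trans (mxrankS _) (rank_adds (rank_row3 (d 1)) (rank_row3 (r w 3))).
  by rewrite !addsmx_sub addsmxSl addsmxSr submx_addl.
- apply: leq_trans (mxrankS _) (rank_adds (rank_row3 (d 1)) (rank_row3 (r w 2))).
  by rewrite !addsmx_sub addsmxSl addsmxSr submx_addl.
by case: lw => [|[]]; matrix_cases; apply/orP;
  first [by left; rewrite ?sub0mx ?scalemx_sub | by right; rewrite ?sub0mx ?scalemx_sub].
Qed.

(** Supplies the column for [Imax_le1]; column 2 or column 3 always works. *)
Lemma coord_condition (w : 'M['F_p]_3) : inA eta 3 6 w \/ inB eta 1 12 w \/ inC 5 8 w \/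
    inA eta 1 2 w \/ inB eta 17 18 w ->
  exists j, [/\ j != ix 1, (r w 1) 0 j = 0 & ((r w 2) 0 j != 0) || ((r w 3) 0 j != 0)].
Proof.
move=> lw; suff [[w1j wj]|[w1j wj]] :
    (r w 1) 0 (ix 2) = 0 /\ ((r w 2) 0 (ix 2) != 0) || ((r w 3) 0 (ix 2) != 0) \/
    (r w 1) 0 (ix 3) = 0 /\ ((r w 2) 0 (ix 3) != 0) || ((r w 3) 0 (ix 3) != 0).
- by exists (ix 2); rewrite ix_neq.
- by exists (ix 3); rewrite ix_neq.
by case: lw => [|[|[|[]]]]; matrix_cases; rewrite ?mxE ?row_simpl ?mulr0 ?mulr1 /= ?mulr1n ?mulr0n
  ?mulr0 ?mulr1 ?eqxx ?h1 ?h2 ?h3 /= ?orbT; first [by left | by right].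
Qed.

Lemma rank123_eq3 (w : 'M['F_p]_3) : inA eta 1 2 w \/ inB eta 17 18 w ->
  \rank (d 1 + (r w 2 + r w 3))%MS = 3%N /\ (r w 1 <= d 1)%MS.
Proof.
move=> lw; split; last by case: lw; matrix_cases; rewrite ?sub0mx ?scalemx_sub.
by case: lw; matrix_cases; apply: delta_full; rewrite ?addsmxSl // submx_addr //;
  first [by rewrite submx_addl ?eqmx_scale | by rewrite submx_addr ?eqmx_scale].
Qed.

Lemma rank213_le1 (w : 'M['F_p]_3) : inB eta 18 18 w ->
  (\rank (d 2 + (r w 1 + r w 3))%MS <= 1)%N.
Proof.
move=> lw; apply: leq_trans (mxrankS _) (rank_row3 (d 2)).
by rewrite !addsmx_sub submx_refl; move: lw; matrix_cases; rewrite sub0mx scalemx_sub.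
Qed.

(** Gives the last hypothesis of [Imax_le0] without m_1 > m_2 + 1: (A1) and (A2) have w_1 nonzero,
    and (B17) meets the condition on the third column, which (B18) fails. *)
Lemma coord_condition2 (w : 'M['F_p]_3) : inA eta 1 2 w \/ inB eta 17 17 w ->
  r w 1 != 0 \/ (r w 2) 0 (ix 3) = 0 /\ (r w 3) 0 (ix 3) != 0.
Proof.
by case; matrix_cases; rewrite ?mxE ?row_simpl /= ?mulr1n ?mulr0n ?mulr0 ?mulr1;
  first [by left; rewrite scaler_eq0 negb_or h1 delta_neq0 | by right].
Qed.

End Matrices.

(** * Comparison of the computed indices with the list *)

Unset Implicit Arguments.
Set Strict Implicit.

Theorem theorem3p3 (p : nat) (p_prime : prime p)
    (eta : 'F_p) (eta_nonres : odd p -> nonresidue eta)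
    (gT : finGroupType) (G : {group gT}) (pG : p.-group G)
    (dG : 'm(G) = 3) (PhiG : 'Phi(G) \subset 'Z(G))
    (abelemG' : p.-abelem G^`(1)) (cardG' : #|G^`(1)| = (p ^ 3)%N)
    (m1 m2 m3 : nat) (m3_ge1 : (1 <= m3)%N)
    (m3_lt_m2 : (m3 < m2)%N) (m2_lt_m1 : (m2 < m1)%N)
    (typeG : abelian_type (G / G^`(1)) = [:: p ^ m1; p ^ m2; p ^ m3]%N)
    (w : 'M['F_p]_3) (charG : char_matrix m1 m2 m3 G w)
    (w_listed : inA eta 1 6 w \/ inB eta 1 18 w \/ inC 1 10 w)
    (Imin Imax : nat) (Imin_G : is_Imin p G Imin) (Imax_G : is_Imax p G Imax) :
  (Imin = m3 ->
     inA eta 1 6 w \/ inB eta 1 4 w \/ inB eta 15 16 w) /\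
  (Imin = m3.+1 ->
     inB eta 5 14 w \/ inB eta 17 18 w \/ inC 1 6 w) /\
  (Imin = m3.+2 ->
     inC 7 10 w) /\
  (Imax = m1.+2 ->
     inB eta 13 16 w \/ inC 1 4 w \/ inC 9 10 w) /\
  (Imax = m1.+1 ->
     inA eta 3 6 w \/ inB eta 1 12 w \/
     (inB eta 18 18 w /\ m1 = m2.+1) \/ inC 5 8 w) /\
  (Imax = m1 ->
     inA eta 1 2 w \/ inB eta 17 17 w \/
     (inB eta 18 18 w /\ (m2.+1 < m1)%N)).
Proof.
case: charG => a1 [a2 [a3 /= [[Ga1 Ga2 Ga3] defG [o1 o2 o3] [pow1 pow2 pow3]]]].
have rowE i : [~ a2, a3] ^+ w (ix i) (ix 1) * [~ a3, a1] ^+ w (ix i) (ix 2)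
    * [~ a1, a2] ^+ w (ix i) (ix 3) = gp [~ a2, a3] [~ a3, a1] [~ a1, a2] (row (ix i) w).
  by rewrite /gp !mxE.
rewrite !rowE in pow1 pow2 pow3.
have IminE := Imin_rank p_prime pG PhiG abelemG' cardG' m3_ge1 m3_lt_m2 m2_lt_m1
  Ga1 Ga2 Ga3 defG o1 o2 o3 pow1 pow2 pow3 Imin_G.
have ge23 := Imax_ge23 p_prime pG PhiG abelemG' cardG' Ga1 Ga2 Ga3 defG o1 o2 o3
  pow2 pow3 Imax_G.
have ge13 := Imax_ge31 p_prime pG PhiG abelemG' cardG' Ga1 Ga2 Ga3 defG o1 o2 o3
  pow1 pow3 Imax_G.
have le1 := Imax_le1 p_prime pG PhiG abelemG' cardG' m3_ge1 m3_lt_m2 m2_lt_m1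
  Ga1 Ga2 Ga3 defG pow1 pow2 pow3 Imax_G.
have le0 := Imax_le0 p_prime pG PhiG abelemG' cardG' m3_ge1 m3_lt_m2 m2_lt_m1
  Ga1 Ga2 Ga3 defG pow1 pow2 pow3 Imax_G.
(* Separates the three statements on I_min from those on I_max. *)
have conj3 (A B C D : Prop) : A /\ B /\ C -> D -> A /\ B /\ C /\ D by case=> ? [].
apply: conj3.
  case: (listed_Imin w_listed) => lw.
  - move: IminE; rewrite (rank12_eq2 eta_nonres lw) addnK => ->.
    by split=> [//|]; split=> E; exfalso; move: E; clear; lia.
  - move: IminE; rewrite (rank12_eq1 eta_nonres lw) => E.
    by repeat split => //; move=> F; exfalso; move: E F; clear; lia.
  move: IminE; rewrite (rank12_eq0 lw) => E.
  by repeat split => //; move=> F; exfalso; move: E F; clear; lia.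
have [lw|lw|lw|lw] := listed_Imax w_listed.
- have {}ge23 := leq_trans (leq_sub2l _ (rank123_le1 lw)) ge23.
  by repeat split => //; move=> F; exfalso; move: ge23 F; clear; lia.
- have {}ge23 := leq_trans (leq_sub2l _ (rank123_le2 eta_nonres lw)) ge23.
  have /(coord_condition eta_nonres)[j [j1 w1j wj]] :
      inA eta 3 6 w \/ inB eta 1 12 w \/ inC 5 8 w \/ inA eta 1 2 w \/ inB eta 17 18 w.
    by case: lw => [|[]]; [left|right; left|right; right; left].
  have {}le1 := le1 _ j1 w1j wj.
  split; first by move=> F; exfalso; move: le1 F; clear; lia.
  split; last by move=> F; exfalso; move: ge23 F; clear; lia.
  by case: lw => [|[]]; [left|right; left|right; right; right].
- have lw' : inA eta 1 2 w \/ inB eta 17 18 w.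
    by case: lw => [|[k /andP[k17 k18] wk]]; [left|right; exists k => //; rewrite k17 ltnW].
  have [rk w1d] := rank123_eq3 eta_nonres lw'.
  have {}le0 : Imax <= m1.
    by apply: le0 => //; case: (coord_condition2 eta_nonres lw) => [?|?]; [apply: Or32|apply: Or33].
  split; first by move=> F; exfalso; move: le0 F; clear; lia.
  split; first by move=> F; exfalso; move: le0 F; clear; lia.
  by case: lw; [left|right; left].
have lw' : inA eta 1 2 w \/ inB eta 17 18 w.
  by case: lw => k /andP[k17 k18] wk; right; exists k => //; rewrite k18 ltnW.
have [rk w1d] := rank123_eq3 eta_nonres lw'.
have /(coord_condition eta_nonres)[j [j1 w1j wj]] :
      inA eta 3 6 w \/ inB eta 1 12 w \/ inC 5 8 w \/ inA eta 1 2 w \/ inB eta 17 18 w.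
  by right; right; right.
have {}le1 := le1 _ j1 w1j wj.
have {}ge13 := leq_trans (leq_sub2l _ (rank213_le1 lw)) ge13.
split; first by move=> F; exfalso; move: le1 F; clear; lia.
(* For (B18), I_max <= m_1 if m_1 > m_2 + 1; if m_1 = m_2 + 1, [ge13] gives I_max >= m_2 + 2 = m_1 +
   1. *)
have [lt2|le2] := ltnP m2.+1 m1.
  have {}le0 : Imax <= m1 by apply: le0 => //; apply: Or31.
  split; first by move=> F; exfalso; move: le0 F; clear; lia.
  by right; right.
have m1E : m1 = m2.+1 by apply/eqP; rewrite eqn_leq le2.
split; first by right; right; left.
by move=> F; exfalso; move: ge13 F m1E; clear; lia.
Qed.
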